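(* For every $p\in[1,\infty)$ and $\alpha\in(0,1)$ there exist constants $\mathsf K_{p,\alpha},\mathsf C_\alpha\in(0,\infty)$ (with $\mathsf C_\alpha$ depending only on $\alpha$) such that for every normed space $(X,\|\cdot\|_X)$, every $n\in\mathbb N$ and every $f:\{-1,1\}^n\to X$, $$\Big\| f-\int f\,d\mu_\alpha^n\Big\|_{L_p(\log L)^{p/2}(\mu_\alpha^n;X)} \le \mathsf K_{p,\alpha}\Big(\int_{\{-1,1\}^n}\Big\|\sum_{i=1}^n\delta_i\partial_i^\alpha f\Big\|_{L_p(\mu_\alpha^n;X)}^p d\sigma_n(\delta)\Big)^{1/p} + \mathsf C_\alpha(\log n+1)\int_{\{-1,1\}^n}\Big\|\sum_{i=1}^n\delta_i\partial_i^\alpha f\Big\|_{L_1(\mu_\alpha^n;X)}d\sigma_n(\delta).$$ If moreover $X$ has finite cotype, then there is a constant $\mathsf K_{p,\alpha}(X)\in(0,\infty)$ (depending on $p,\alpha,X$ only) such that for all $n$ and all $f:\{-1,1\}^n\to X$, $$\Big\| f-\int f\,d\mu_\alpha^n\Big\|_{L_p(\log L)^{p/2}(\mu_\alpha^n;X)} \le \mathsf K_{p,\alpha}(X)\Big(\int_{\{-1,1\}^n}\Big\|\sum_{i=1}^n\delta_i\partial_i^\alpha f\Big\|_{L_p(\mu_\alpha^n;X)}^p d\sigma_n(\delta)\Big)^{1/p}.$$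
   Context: For $\alpha\in(0,1)$, $\mu_\alpha$ is the probability measure on $\{-1,1\}$ with $\mu_\alpha\{1\}=\alpha$, $\mu_\alpha\{-1\}=1-\alpha$, and $\mu_\alpha^n$ is its $n$-fold product on $\{-1,1\}^n$; $\sigma_n$ is the uniform probability measure on $\{-1,1\}^n$. For $\beta\in(0,1)$, $f:\{-1,1\}^n\to X$ and $x\in\{-1,1\}^n$, $\partial_i^\beta f(x)=f(x)-\beta f(x_1,\dots,x_{i-1},1,x_{i+1},\dots,x_n)-(1-\beta)f(x_1,\dots,x_{i-1},-1,x_{i+1},\dots,x_n)$. In the expressions above, for fixed $\delta\in\{-1,1\}^n$, $\sum_i\delta_i\partial_i^\alpha f$ is regarded as a function of $x$ and its $L_p(\mu_\alpha^n;X)$ norm is $(\int\|\cdot\|_X^p d\mu_\alpha^n)^{1/p}$. For a probability space $(\Omega,\mu)$ and $g:\Omega\to X$, the Orlicz norm is $\|g\|_{L_p(\log L)^a(\mu;X)}=\inf\{\gamma>0:\int_\Omega\frac{\|g\|_X^p}{\gamma^p}\log^a(e+\frac{\|g\|_X^p}{\gamma^p})\,d\mu\le1\}$. $X$ has cotype $q\in[2,\infty)$ if there is $C$ with $\int\|\sum_{i=1}^n x_iv_i\|_X^q d\sigma_n(x)\ge C^{-q}\sum_i\|v_i\|_X^q$ for all $n$ and $v_1,\dots,v_n\in X$; finite cotype means cotype $q$ for some $q<\infty$. *)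

(* Defs.v *)
From HB Require Import structures.
From mathcomp Require Import all_boot all_order all_algebra.
From mathcomp Require Import all_classical all_reals all_analysis.
Set Implicit Arguments. Unset Strict Implicit. Unset Printing Implicit Defensive.
Import Order.TTheory GRing.Theory Num.Theory.
Import numFieldNormedType.Exports.
Local Open Scope classical_set_scope.
Local Open Scope ring_scope.

(* The discrete cube {-1,1}^n: a point is x : 'I_n -> bool, true <-> +1, false <-> -1. *)
Definition cube (n : nat) := {ffun 'I_n -> bool}.

Section Defs.
Variable R : realType.

Definition sgn (b : bool) : R := if b then 1 else -1.

Definition mu (a : R) (n : nat) (x : cube n) : R :=
  \prod_(i < n) (if x i then a else 1 - a).

Definition sigma (n : nat) (x : cube n) : R := (2 ^+ n)^-1.

Definition setc (n : nat) (x : cube n) (i : 'I_n) (b : bool) : cube n :=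
  [ffun j => if j == i then b else x j].

Variable X : normedModType R.

Definition mean (a : R) (n : nat) (f : cube n -> X) : X :=
  \sum_(x : cube n) mu a x *: f x.

Definition dpart (b : R) (n : nat) (f : cube n -> X) (i : 'I_n) (x : cube n) : X :=
  f x - b *: f (setc x i true) - (1 - b) *: f (setc x i false).

Definition Dsum (a : R) (n : nat) (f : cube n -> X) (d : cube n) (x : cube n) : X :=
  \sum_(i < n) sgn (d i) *: dpart a f i x.

Definition Lpnorm (p a : R) (n : nat) (g : cube n -> X) : R :=
  (\sum_(x : cube n) mu a x * (`|g x| `^ p)) `^ p^-1.

Definition orlicz (p c a : R) (n : nat) (g : cube n -> X) : R :=
  inf [set gam : R | 0 < gam /\
    \sum_(x : cube n) mu a x *
      ((`|g x| `^ p / gam `^ p) * (ln (expR 1 + `|g x| `^ p / gam `^ p)) `^ c) <= 1].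

Definition has_cotype (q : R) : Prop :=
  exists C : R, 0 < C /\ forall (n : nat) (v : 'I_n -> X),
    \sum_(x : cube n) sigma x * (`| \sum_(i < n) sgn (x i) *: v i | `^ q)
      >= C `^ (- q) * \sum_(i < n) `|v i| `^ q.

Definition finite_cotype : Prop := exists q : R, 2 <= q /\ has_cotype q.

End Defs.

(* Main.v *)
Require Import Defs.
From HB Require Import structures.
From mathcomp Require Import all_boot all_order all_algebra.
From mathcomp Require Import all_classical all_reals all_analysis.
From mathcomp Require Import ring lra.
Import Order.TTheory GRing.Theory Num.Theory.
Import numFieldNormedType.Exports.
Local Open Scope classical_set_scope.
Local Open Scope ring_scope.

(* For h = |f - E f|, let M h x be the l2-norm of the increments
   (h x - h (x^i))_+ over the neighbours x^i of x.

   (1) J t = t sqrt(ln (8 / t)) satisfies a two-point inequality that tensorizes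
   to J (E g) <= E sqrt(J(g)^2 + c (M g)^2) for g with values in [0, 1].
   Applied to the dyadic slices of v >= 0 this bounds E v sqrt(ln (e + v)) by
   E (M v) + 1/4 when v has small support.  Taking for v a suitable function of
   (h - m)_+ and using Young's inequality gives
   |h|_{L_p (log L)^{p/2}} <= K_p |M h|_p + C E h, with C independent of p.

   (2) M h x <= K E_delta |sum_i delta_i d_i f x|: convexity of the norm gives
   sum_i b_i^2 <= |sum_i b_i (f x - f (x^i))| for the increments b_i, and a Riesz
   product bounds |sum_i c_i v_i| by 2 E_delta |sum_i delta_i v_i| if |c|_2 <= 1.

   (3) E |f - E f| is estimated along T_r (x, y) = E_b f (b ? x : y), where the b_i
   are independent Bernoulli(r).  The derivative of T_r in r is
   E_b sum_i (b_i - r) / (r (1 - r)) d_i f (b ? x : y), so a dyadic interval of r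
   costs O(1) Rademacher averages; log n intervals suffice.  If X has cotype q,
   then for small r the averages with coefficients b_i - r gain a factor r^{1/q},
   and the sum over all intervals converges. The equivalence of moments of
   Rademacher sums used here is an instance of (1) and (2). *)

Set Implicit Arguments.
Unset Strict Implicit.
Unset Printing Implicit Defensive.

#[local] Opaque powR expR ln.

(** * Product measures on the cube *)

(** Only drops of the norm towards a neighbour can be controlled by one Rademacher average taken at
    the same point. At u = 0 every increment is a rise |d_i|, and the l2-norm of these has no such
    bound in a general normed space (unit vectors of l_infinity^n). Hence slicing and the chain rule
    for powers are proved in one-sided form. J imitates the Gaussian isoperimetric profile near 0,
    of order t sqrt(ln (1/t)); this square root is the source of the exponent p/2. The second
    constant may not depend on p. Cutting h at a level m proportional to E h leaves, by Markov, an
    excess of small support, while the bounded part costs a multiple of E h that is uniform in p. In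
    the interpolation the factor 1/r is not integrable at 0. The path stops at r of order 1/n, where
    T_r (x, y) is so close to f y that the error is absorbed by E |f - E f| itself; the gain r^{1/q}
    restores integrability. *)

Definition flip (n : nat) (x : cube n) (i : 'I_n) : cube n := setc x i (~~ x i).

Lemma flipK n (i : 'I_n) : involutive (fun x : cube n => flip x i).
Proof.
move=> x; apply/ffunP => j; rewrite !ffunE eqxx.
by case: eqP => [->|//]; rewrite negbK.
Qed.

Lemma flip_at n (x : cube n) i : flip x i i = ~~ x i.
Proof. by rewrite ffunE eqxx. Qed.

Lemma setc_flip n (x : cube n) i b : setc (flip x i) i b = setc x i b.
Proof. by apply/ffunP => j; rewrite !ffunE; case: (j == i). Qed.

Lemma setc_id n (x : cube n) i : setc x i (x i) = x.
Proof. by apply/ffunP => j; rewrite ffunE; case: eqP => [->|]. Qed.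

Lemma setcC n (x : cube n) i j b c : i != j ->
  setc (setc x i b) j c = setc (setc x j c) i b.
Proof.
move=> ij; apply/ffunP => k; rewrite !ffunE.
by case: (eqVneq k j) => // ->; rewrite eq_sym (negPf ij).
Qed.

Lemma flip_setc n (x : cube n) i j b : i != j ->
  flip (setc x i b) j = setc (flip x j) i b.
Proof. by move=> ij; rewrite /flip ffunE eq_sym (negPf ij) setcC. Qed.

Lemma setc_flip_cases n (x : cube n) i :
  if x i then setc x i true = x /\ setc x i false = flip x i
  else setc x i false = x /\ setc x i true = flip x i.
Proof. by case xi: (x i); have := setc_id x i; rewrite /flip xi. Qed.

Section CubeMeasure.
Variables (R : realType).
Implicit Types (a : R) (n : nat).

Lemma mu_ge0 a n (x : cube n) : 0 <= a <= 1 -> 0 <= mu a x.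
Proof. by move=> /andP[a0 a1]; apply: prodr_ge0 => i _; case: ifP => _ //; lra. Qed.

Lemma sum_mu a n : \sum_(x : cube n) mu a x = 1.
Proof.
rewrite -(bigA_distr_bigA (fun (_ : 'I_n) (b : bool) => if b then a else 1 - a)).
by rewrite big1 // => i _; rewrite big_bool /= subrKC.
Qed.

Lemma sigma_mu n (x : cube n) : sigma R x = mu 2^-1 x.
Proof.
rewrite /sigma /mu (eq_bigr (fun=> 2^-1)) => [|i _]; last by case: ifP => _; lra.
by rewrite prodr_const card_ord exprVn.
Qed.

Definition mu_off a n (x : cube n) (i : 'I_n) :=
  \prod_(j < n | j != i) (if x j then a else 1 - a).

Lemma muE a n (x : cube n) i : mu a x = (if x i then a else 1 - a) * mu_off a x i.
Proof. by rewrite /mu (bigD1 i). Qed.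

Lemma mu_off_flip a n (x : cube n) i : mu_off a (flip x i) i = mu_off a x i.
Proof. by apply: eq_bigr => j /negPf ji; rewrite ffunE ji. Qed.

Lemma mu_flip a n (x : cube n) i :
  mu a (flip x i) = (if x i then 1 - a else a) * mu_off a x i.
Proof. by rewrite (muE _ _ i) mu_off_flip flip_at; case: (x i). Qed.

Lemma sum_flip (V : nmodType) n (i : 'I_n) (F : cube n -> V) :
  \sum_(x : cube n) F (flip x i) = \sum_(x : cube n) F x.
Proof. by rewrite [RHS](reindex_inj (inv_inj (@flipK n i))). Qed.

Section Averages.
Variable V : lmodType R.

Definition avg a n (i : 'I_n) (F : cube n -> V) (x : cube n) : V :=
  a *: F (setc x i true) + (1 - a) *: F (setc x i false).

Lemma avg_flip a n (i : 'I_n) (F : cube n -> V) x : avg a i F (flip x i) = avg a i F x.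
Proof. by rewrite /avg !setc_flip. Qed.

Lemma sum_mu_avg a n (i : 'I_n) (F : cube n -> V) :
  \sum_(x : cube n) mu a x *: avg a i F x = \sum_(x : cube n) mu a x *: F x.
Proof.
have pair (G : cube n -> V) : \sum_(x : cube n) G x =
    2^-1 *: \sum_(x : cube n) (G x + G (flip x i)).
  rewrite big_split /= sum_flip scalerDr -scalerDl.
  by rewrite -[LHS]scale1r; congr (_ *: _); lra.
rewrite pair [RHS]pair; congr (_ *: _); apply: eq_bigr => x _.
rewrite avg_flip -scalerDl mu_flip (muE _ _ i) /avg.
case: (x i) (setc_flip_cases x i) => -[-> ->]; rewrite scalerDr !scalerA -!mulrDl.
  by rewrite subrKC mul1r ![_ * mu_off _ _ _]mulrC.
by rewrite subrK mul1r ![_ * mu_off _ _ _]mulrC addrC.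
Qed.

End Averages.

Definition Ex a n (F : cube n -> R) : R := \sum_(x : cube n) mu a x * F x.

Definition ravg a n (i : 'I_n) (F : cube n -> R) (x : cube n) : R :=
  a * F (setc x i true) + (1 - a) * F (setc x i false).

Lemma ravg_flip a n (i : 'I_n) (F : cube n -> R) x : ravg a i F (flip x i) = ravg a i F x.
Proof. by rewrite /ravg !setc_flip. Qed.

Lemma Ex_ravg a n (i : 'I_n) (F : cube n -> R) : Ex a (ravg a i F) = Ex a F.
Proof. exact: (@sum_mu_avg R^o). Qed.

Lemma Ex_cst a n (c : R) : Ex a (fun _ : cube n => c) = c.
Proof. by rewrite /Ex -mulr_suml sum_mu mul1r. Qed.

Lemma ExD a n (F G : cube n -> R) : Ex a (fun x => F x + G x) = Ex a F + Ex a G.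
Proof. by rewrite /Ex -big_split /=; apply: eq_bigr => x _; rewrite mulrDr. Qed.

Lemma ExZ a n c (F : cube n -> R) : Ex a (fun x => c * F x) = c * Ex a F.
Proof. by rewrite /Ex mulr_sumr; apply: eq_bigr => x _; rewrite mulrCA. Qed.

Lemma Ex_sum a n (I : Type) (r : seq I) (P : pred I) (F : I -> cube n -> R) :
  Ex a (fun x => \sum_(i <- r | P i) F i x) = \sum_(i <- r | P i) Ex a (F i).
Proof. by rewrite /Ex exchange_big /=; apply: eq_bigr => x _; rewrite mulr_sumr. Qed.

Lemma le_Ex a n (F G : cube n -> R) : 0 <= a <= 1 -> (forall x, F x <= G x) ->
  Ex a F <= Ex a G.
Proof. by move=> a01 FG; apply: ler_sum => x _; rewrite ler_wpM2l ?mu_ge0. Qed.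

Lemma Ex_ge0 a n (F : cube n -> R) : 0 <= a <= 1 -> (forall x, 0 <= F x) ->
  0 <= Ex a F.
Proof. by move=> a01 F0; apply: sumr_ge0 => x _; rewrite mulr_ge0 ?mu_ge0. Qed.

Lemma eq_Ex a n (F G : cube n -> R) : F =1 G -> Ex a F = Ex a G.
Proof. by move=> FG; apply: eq_bigr => x _; rewrite FG. Qed.

Lemma exchange_Ex a b n m (F : cube n -> cube m -> R) :
  Ex a (fun x => Ex b (F x)) = Ex b (fun y => Ex a (F^~ y)).
Proof.
rewrite /Ex; under eq_bigr do rewrite mulr_sumr.
rewrite exchange_big /=; apply: eq_bigr => y _; rewrite mulr_sumr.
by apply: eq_bigr => x _; rewrite mulrCA.
Qed.

Lemma flip_invariant_const (T : Type) n (F : cube n -> T) :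
  (forall i x, F (flip x i) = F x) -> forall x y, F x = F y.
Proof.
move=> Ff x y; set s := enum 'I_n.
have step (t : seq 'I_n) : exists2 z : cube n,
    F z = F x & forall j, z j = if j \in t then y j else x j.
  elim: t => [|i t [z Fz zE]]; first by exists x.
  exists (if z i == y i then z else flip z i); first by case: ifP; rewrite ?Ff.
  move=> j; rewrite inE; case: (eqVneq j i) => [->|ji] /=.
    by case: eqP => [//|]; rewrite flip_at; case: (z i); case: (y i).
  by rewrite -zE; case: ifP => // _; rewrite ffunE (negPf ji).
have [z <- zE] := step (enum 'I_n).
by congr F; apply/ffunP => j; rewrite zE mem_enum.
Qed.

End CubeMeasure.

(** * A one-sided isoperimetric inequality *)

Section Isoperimetry.
Variable R : realType.
Implicit Types a s t : R.

Definition pos (x : R) : R := Num.max x 0.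

Lemma pos_ge0 (x : R) : 0 <= pos x.
Proof. by rewrite /pos le_max lexx orbT. Qed.

Lemma ge0_pos (x : R) : 0 <= x -> pos x = x.
Proof. by move=> x0; apply/max_idPl. Qed.

Lemma le0_pos (x : R) : x <= 0 -> pos x = 0.
Proof. by move=> x0; apply/max_idPr. Qed.

Lemma le_pos (x : R) : x <= pos x.
Proof. by rewrite /pos le_max lexx. Qed.

Lemma pos_le (x y : R) : 0 <= y -> x <= y -> pos x <= y.
Proof. by move=> y0 xy; rewrite /pos ge_max xy. Qed.

(** The factor 8 keeps the logarithm at least 1 on (0, 1]; its size is used in [sum_lam]. *)
Definition J t : R := t * Num.sqrt (ln (8 / t)).

Lemma J0 : J 0 = 0. Proof. by rewrite /J mul0r. Qed.

(** [1 + x <= expR x] at x = -1/3, cubed, gives e <= 27/8. *)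
Lemma expR1_le4 : expR 1 <= 4 :> R.
Proof.
have h : 2 / 3 <= expR (- (1 / 3)) :> R by have := @expR_ge1Dx R (- (1 / 3)); lra.
have h1 : expR (- (1 / 3)) ^+ 3 * expR 1 = 1 :> R.
  by rewrite -expRM_natl -expRD -[RHS]expR0; congr expR; lra.
have h2 : (2 / 3) ^+ 3 <= expR (- (1 / 3)) ^+ 3 :> R by rewrite lerXn2r ?nnegrE ?expR_ge0 //; lra.
have := ler_wpM2r (expR_ge0 1) h2; rewrite h1; lra.
Qed.

Lemma ln8_ge1 t : 0 < t -> t <= 1 -> 1 <= ln (8 / t).
Proof.
move=> t0 t1; have e4 := expR1_le4.
rewrite -[leLHS]expRK ler_ln ?posrE ?expR_gt0 ?divr_gt0 //.
rewrite ler_pdivlMr //; have := expR_gt0 (1 : R); nra.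
Qed.

Lemma J_ge0 t : 0 <= t -> 0 <= J t.
Proof. by move=> t0; rewrite mulr_ge0 ?sqrtr_ge0. Qed.

Lemma J_ge t : 0 <= t <= 1 -> t <= J t.
Proof.
move=> /andP[t0 t1]; move: t0; rewrite le_eqVlt => /predU1P[<-|t0]; first by rewrite J0.
rewrite /J ler_peMr ?(ltW t0) // -[leLHS]sqrtr1 ler_wsqrtr //; exact: ln8_ge1.
Qed.

Lemma J_le3 t : 0 <= t <= 1 -> J t <= 3.
Proof.
move=> /andP[t0 t1]; move: t0; rewrite le_eqVlt => /predU1P[<-|t0]; first by rewrite J0.
have L1 := ln8_ge1 t0 t1.
have L2 : ln (8 / t) < 8 / t by apply: ln_sublinear; rewrite divr_gt0.
rewrite -(@ler_pXn2r _ 2) ?nnegrE ?J_ge0 ?(ltW t0) //.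
rewrite /J exprMn sqr_sqrtr; last by lra.
have L3 : t * ln (8 / t) <= 8 by move: L2; rewrite ltr_pdivlMr // mulrC => /ltW.
by rewrite expr2 -mulrA; nra.
Qed.

(* lm, lt, ls stand for sqrt(ln (8 / .)) at the barycentre m, at t and at s. *)
Lemma gap_alg a s t lm lt ls : 0 < a < 1 -> 0 <= s <= t -> 0 < t ->
  let m := a * t + (1 - a) * s in
  1 <= lt -> lt <= lm -> lm <= ls ->
  m * (lm ^+ 2 - lt ^+ 2) <= (1 - a) * (t - s) ->
  a * (t - s) <= m * (ls ^+ 2 - lm ^+ 2) ->
  s * (ls ^+ 2 - lt ^+ 2) <= t - s ->
  t * lt * (m * lm - a * (t * lt) - (1 - a) * (s * ls)) <= (1 - a) * (t - s) ^+ 2.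
Proof.
move=> /andP[a0 a1] /andP[s0 st] t0 m l1 ltm lms h1 h2 h3.
set d := t - s in h1 h2 h3 *.
have d0 : 0 <= d by rewrite /d; lra.
have mt : a * t <= m by rewrite /m; nra.
have m0 : 0 < m by nra.
have e1 : m * (lm - lt) * (lm + lt) <= (1 - a) * d by rewrite -mulrA -subr_sqr.
have e2 : a * d <= m * (ls - lm) * (ls + lm) by rewrite -mulrA -subr_sqr.
have e3 : s * (ls - lt) * (ls + lt) <= d by rewrite -mulrA -subr_sqr.
pose u := lm + lt; pose v := ls + lm.
have u0 : 0 < u by rewrite /u; lra.
have v0 : 0 < v by rewrite /v; lra.
have f1 : m * (lm - lt) <= (1 - a) * d / u by rewrite ler_pdivlMr.
have f2 : a * d / v <= m * (ls - lm) by rewrite ler_pdivrMr.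
have f3 : s * (ls - lt) <= d / (2 * lt).
  rewrite ler_pdivlMr; last by lra.
  apply: le_trans e3; apply: ler_wpM2l; last by lra.
  by rewrite mulr_ge0 //; lra.
pose G := m * lm - a * (t * lt) - (1 - a) * (s * ls).
have gE : G = a * t * (lm - lt) - (1 - a) * s * (ls - lm) by rewrite /G /m; ring.
have g1 : m * G <= a * (1 - a) * d * (t / u - s / v).
  rewrite gE.
  have -> : m * (a * t * (lm - lt) - (1 - a) * s * (ls - lm)) =
     a * t * (m * (lm - lt)) - (1 - a) * s * (m * (ls - lm)) by ring.
  have -> : a * (1 - a) * d * (t / u - s / v) =
     a * t * ((1 - a) * d / u) - (1 - a) * s * (a * d / v) by ring.
  by apply: lerB; apply: ler_wpM2l => //; rewrite mulr_ge0 //; lra.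
(* Since [v - u = ls - lt], passing from s / v to s / u costs [s * (ls - lt) / (u * v)], which [f3]
   controls. *)
have bE : t / u - s / v = d / u + s * (ls - lt) / (u * v).
  rewrite /d /u /v; field; apply/andP; split; rewrite gt_eqF //; lra.
have b1 : d / u <= d / (2 * lt).
  by apply: ler_wpM2l => //; rewrite lef_pV2 ?posrE /u; lra.
have b2 : s * (ls - lt) / (u * v) <= d / (2 * lt).
  have uv1 : 1 <= u * v by rewrite /u /v; nra.
  rewrite ler_pdivrMr ?mulr_gt0 //; apply: le_trans f3 _.
  by apply: ler_peMr => //; rewrite divr_ge0 //; lra.
have b3 : t / u - s / v <= d / lt.
  have -> : d / lt = d / (2 * lt) + d / (2 * lt) by field; rewrite gt_eqF //; lra.
  by rewrite bE lerD.
have g2 : m * G <= a * (1 - a) * d * (d / lt).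
  by apply: le_trans g1 _; apply: ler_wpM2l => //; rewrite !mulr_ge0 //; lra.
have g3 : m * G * lt <= a * (1 - a) * d ^+ 2.
  have -> : a * (1 - a) * d ^+ 2 = a * (1 - a) * d * (d / lt) * lt.
    by field; rewrite gt_eqF //; lra.
  by apply: ler_wpM2r => //; lra.
change (t * lt * G <= (1 - a) * d ^+ 2).
case: (lerP G 0) => [G0|G0].
  apply: (@le_trans _ _ 0); last by rewrite mulr_ge0 ?sqr_ge0 //; lra.
  by rewrite mulr_ge0_le0 // mulr_ge0 //; lra.
rewrite -(ler_pM2l a0); apply: le_trans (le_trans g3 _); last by rewrite -mulrA.
have -> : a * (t * lt * G) = a * t * (G * lt) by ring.
by rewrite -[leRHS]mulrA; apply: ler_wpM2r => //; rewrite mulr_ge0 ?ltW //; lra.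
Qed.

Lemma ln_le_sub1 (x : R) : 0 < x -> ln x <= x - 1.
Proof. by move=> x0; have := @le_ln1Dx R (x - 1); rewrite subrKC; apply; lra. Qed.

(** The three logarithmic hypotheses of [gap_alg] are [ln z <= z - 1] at z = t / m, s / m and t / s,
    where m is the barycentre. *)
Lemma J_gap a s t : 0 < a < 1 -> 0 <= s <= t -> 0 < t <= 1 ->
  J (a * t + (1 - a) * s) <= a * J t + (1 - a) * J s + (1 - a) * (t - s) ^+ 2 / J t.
Proof.
move=> a01 /andP[s0 st] /andP[t0 t1].
have [a0 a1] := andP a01.
set m := _ + _.
have Jt0 : 0 < J t by apply: lt_le_trans t0 _; apply: J_ge; lra.
have mt : m <= t by rewrite /m; nra.
have ms : s <= m by rewrite /m; nra.
have m0 : 0 < m by rewrite /m; nra.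
have lnd (x y : R) : 0 < x -> 0 < y -> ln (8 / x) - ln (8 / y) = ln (y / x).
  by move=> x0 y0; rewrite !ln_div ?posrE //; lra.
have lnge (x : R) : 0 < x -> x <= t -> 1 <= ln (8 / x) by move=> x0 xt; apply: ln8_ge1; lra.
have sq (x : R) : 0 < x -> x <= t -> Num.sqrt (ln (8 / x)) ^+ 2 = ln (8 / x).
  by move=> x0 xt; rewrite sqr_sqrtr //; have := lnge _ x0 xt; lra.
have mono (x y : R) : 0 < x -> x <= y -> Num.sqrt (ln (8 / y)) <= Num.sqrt (ln (8 / x)).
  move=> x0 xy; apply: ler_wsqrtr; rewrite ler_ln ?posrE ?divr_gt0 //; last by lra.
  by apply: ler_wpM2l => //; rewrite lef_pV2 ?posrE //; lra.
have l1 : 1 <= Num.sqrt (ln (8 / t)) by rewrite -[leLHS]sqrtr1 ler_wsqrtr ?lnge.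
have h1 : m * (Num.sqrt (ln (8 / m)) ^+ 2 - Num.sqrt (ln (8 / t)) ^+ 2) <= (1 - a) * (t - s).
  rewrite !sq // lnd //; have := ln_le_sub1 (divr_gt0 t0 m0) => h.
  have -> : (1 - a) * (t - s) = m * (t / m - 1) by rewrite /m; field; rewrite gt_eqF.
  by apply: ler_wpM2l => //; exact: ltW.
suff key : J t * (J m - a * J t - (1 - a) * J s) <= (1 - a) * (t - s) ^+ 2.
  rewrite -[X in _ <= X]addrC -!lerBlDr ler_pdivlMr // mulrC.
  by apply: le_trans key; rewrite opprD addrA.
move: s0; rewrite le_eqVlt => /predU1P[s0|s0].
  (* At s = 0 the root of [ln (8 / s)] has the default value 0, which is on the wrong side of [lm].
     As J 0 = 0, any number can stand in for it; this one is large enough for the hypotheses of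
     [gap_alg]. *)
  have -> : J s = s * (Num.sqrt (ln (8 / m)) + a * t / m) by rewrite -s0 J0 mul0r.
  apply: gap_alg => //.
  - by rewrite -s0 lexx ltW.
  - exact: mono.
  - by rewrite lerDl divr_ge0 ?mulr_ge0 ?ltW.
  - have -> : a * (t - s) = a * t by rewrite -s0 subr0.
    have -> x y : m * ((x + y) ^+ 2 - x ^+ 2) = m * y * (2 * x + y) by ring.
    have -> : m * (a * t / m) = a * t by field; rewrite gt_eqF.
    apply: ler_peMr; first by rewrite mulr_ge0 ?ltW.
    have : 1 <= Num.sqrt (ln (8 / m)) by apply: le_trans l1 _; exact: mono.
    have : 0 <= a * t / m by rewrite divr_ge0 ?mulr_ge0 ?ltW.
    by lra.
  - by rewrite -s0 mul0r subr0 ltW.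
apply: gap_alg => //.
- by rewrite ltW.
- exact: mono.
- exact: mono.
- rewrite !sq // lnd //.
  have := ln_le_sub1 (divr_gt0 s0 m0) => h.
  have -> : ln (m / s) = - ln (s / m) by rewrite !ln_div ?posrE // opprB.
  have -> : a * (t - s) = m * (1 - s / m) by rewrite /m; field; rewrite gt_eqF.
  by apply: ler_wpM2l; [exact: ltW|lra].
- rewrite !sq // lnd //.
  have := ln_le_sub1 (divr_gt0 t0 s0) => h.
  have -> : t - s = s * (t / s - 1) by field; rewrite gt_eqF.
  by apply: ler_wpM2l => //; exact: ltW.
Qed.

(** The square of the left side is [x ^+ 2 + (2 * k + k ^+ 2 * (d / x) ^+ 2) * d ^+ 2], and d <= x.
    This is the origin of the constant [2 * k + k ^+ 2]. *)
Lemma sqrt_add_ge (x d k : R) : 0 < x -> 0 <= d <= x -> 0 <= k ->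
  x + k * d ^+ 2 / x <= Num.sqrt (x ^+ 2 + (2 * k + k ^+ 2) * d ^+ 2).
Proof.
move=> x0 /andP[d0 dx] k0.
have e0 : 0 <= d / x <= 1.
  by apply/andP; split; [rewrite divr_ge0 // ltW | rewrite ler_pdivrMr ?mul1r].
have y0 : 0 <= x + k * d ^+ 2 / x by rewrite addr_ge0 ?divr_ge0 ?mulr_ge0 ?sqr_ge0 // ltW.
rewrite -[X in X <= _](ger0_norm y0) -sqrtr_sqr ler_wsqrtr //.
have -> : (x + k * d ^+ 2 / x) ^+ 2 = x ^+ 2 + (2 * k + k ^+ 2 * (d / x) ^+ 2) * d ^+ 2.
  by field; rewrite gt_eqF.
rewrite lerD2l ler_wpM2r ?sqr_ge0 // lerD2l ler_piMr ?sqr_ge0 //.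
by move/andP: e0 => [e0 e1]; rewrite expr_le1.
Qed.

(** Only the larger endpoint has a positive increment, so the defect from [J_gap] is charged to it
    alone. Its weight b satisfies [1 - b <= b * k], which pays for the missing factor; if s > t,
    then a and 1 - a change places. *)
Lemma J_two_points a (k : R) s t : 0 < a < 1 -> a^-1 <= k -> (1 - a)^-1 <= k ->
  0 <= s <= 1 -> 0 <= t <= 1 ->
  J (a * t + (1 - a) * s) <=
    a * Num.sqrt (J t ^+ 2 + (2 * k + k ^+ 2) * pos (t - s) ^+ 2) +
    (1 - a) * Num.sqrt (J s ^+ 2 + (2 * k + k ^+ 2) * pos (s - t) ^+ 2).
Proof.
have half b u v : 0 < b < 1 -> b^-1 <= k -> 0 <= u -> u <= v -> v <= 1 ->
    J (b * v + (1 - b) * u) <=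
    b * Num.sqrt (J v ^+ 2 + (2 * k + k ^+ 2) * pos (v - u) ^+ 2) +
    (1 - b) * Num.sqrt (J u ^+ 2 + (2 * k + k ^+ 2) * pos (u - v) ^+ 2).
  move=> b01 bk u0 uv v1; have [b0 b1] := andP b01.
  have k0 : 0 <= k by apply: le_trans bk; rewrite invr_ge0 ltW.
  rewrite (@le0_pos (u - v)); last by lra.
  rewrite (@ge0_pos (v - u)); last by lra.
  rewrite expr0n mulr0 addr0 sqrtr_sqr (ger0_norm (J_ge0 u0)).
  have [v0|v0] := lerP v 0.
    have -> : v = 0 by lra. have -> : u = 0 by lra.
    by rewrite !mulr0 addr0 J0 expr0n subrr expr0n /= mulr0 addr0 sqrtr0 !mulr0 addr0.
  have Jv : v <= J v by apply: J_ge; lra.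
  apply: le_trans (J_gap b01 _ _) _; [lra|lra|].
  rewrite addrAC lerD2r.
  have Jv0 : 0 < J v by lra.
  apply: (@le_trans _ _ (b * (J v + k * (v - u) ^+ 2 / J v))); last first.
    by rewrite ler_pM2l //; apply: sqrt_add_ge => //; lra.
  rewrite mulrDr lerD2l -2!mulrA [leRHS]mulrA; apply: ler_wpM2r.
    by rewrite divr_ge0 ?sqr_ge0 // ltW.
  have : 1 <= b * k by rewrite mulrC -ler_pdivrMr ?div1r.
  by lra.
move=> a01 ak bk /andP[s0 s1] /andP[t0 t1].
have [st|ts] := lerP s t; first exact: half.
rewrite addrC [X in _ <= X]addrC.
have e : a = 1 - (1 - a) by lra.
rewrite {2 4}e; apply: half => //; lra.
Qed.

Lemma mink2 a b (z w X x Y y : R) : 0 <= a -> 0 <= b ->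
  0 <= z <= a * X + b * Y -> 0 <= w <= a * x + b * y ->
  Num.sqrt (z ^+ 2 + w ^+ 2) <=
    a * Num.sqrt (X ^+ 2 + x ^+ 2) + b * Num.sqrt (Y ^+ 2 + y ^+ 2).
Proof.
move=> a0 b0 /andP[z0 zX] /andP[w0 wx].
have P0 : 0 <= X ^+ 2 + x ^+ 2 by rewrite addr_ge0 ?sqr_ge0.
have Q0 : 0 <= Y ^+ 2 + y ^+ 2 by rewrite addr_ge0 ?sqr_ge0.
set P := Num.sqrt (X ^+ 2 + _); set Q := Num.sqrt (Y ^+ 2 + _).
have PQ : X * Y + x * y <= P * Q.
  rewrite -sqrtrM //; apply: le_trans (ler_norm _) _; rewrite -sqrtr_sqr ler_wsqrtr //.
  have := sqr_ge0 (X * y - x * Y); lra.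
have aP : 0 <= a * P + b * Q by rewrite addr_ge0 ?mulr_ge0 ?sqrtr_ge0.
rewrite -[X in _ <= X](ger0_norm aP) -sqrtr_sqr ler_wsqrtr //.
apply: (@le_trans _ _ ((a * X + b * Y) ^+ 2 + (a * x + b * y) ^+ 2)).
  by apply: lerD; rewrite lerXn2r ?nnegrE //; lra.
have -> : (a * P + b * Q) ^+ 2 = a ^+ 2 * P ^+ 2 + b ^+ 2 * Q ^+ 2 + 2 * (a * b) * (P * Q) by ring.
rewrite !sqr_sqrtr //.
have := ler_wpM2l (mulr_ge0 a0 b0) PQ; lra.
Qed.

Lemma mink_seq (I : eqType) (r : seq I) a b (z x y : I -> R) : 0 <= a -> 0 <= b ->
  {in r, forall i, 0 <= z i <= a * x i + b * y i} ->
  Num.sqrt (\sum_(i <- r) z i ^+ 2) <=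
    a * Num.sqrt (\sum_(i <- r) x i ^+ 2) + b * Num.sqrt (\sum_(i <- r) y i ^+ 2).
Proof.
move=> a0 b0; elim: r => [_|i r IH h]; first by rewrite !big_nil sqrtr0 !mulr0 addr0.
have s0 (F : I -> R) : 0 <= \sum_(j <- r) F j ^+ 2 by apply: sumr_ge0 => j _; exact: sqr_ge0.
rewrite !big_cons -(sqr_sqrtr (s0 z)) -(sqr_sqrtr (s0 x)) -(sqr_sqrtr (s0 y)).
apply: mink2 => //; first by apply: h; rewrite mem_head.
by rewrite sqrtr_ge0 /=; apply: IH => j jr; apply: h; rewrite inE jr orbT.
Qed.

(** * Tensorization of the two-point inequality over the coordinates *)

Section Tensorization.
Variables (a k : R).
Hypotheses (a01 : 0 < a < 1) (ak : a^-1 <= k) (bk : (1 - a)^-1 <= k).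
Variable n : nat.
Implicit Types (f : cube n -> R) (r : seq 'I_n).

Let c := 2 * k + k ^+ 2.

Let a01' : 0 <= a <= 1. Proof. by have /andP[? ?] := a01; rewrite !ltW. Qed.

Let k0 : 0 <= k.
Proof. by apply: le_trans ak; rewrite invr_ge0; move/andP: a01'=> []. Qed.

Let c0 : 0 <= c. Proof. by rewrite addr_ge0 ?mulr_ge0 ?sqr_ge0. Qed.

Definition gradsq r f (x : cube n) : R := \sum_(j <- r) pos (f x - f (flip x j)) ^+ 2.

Lemma gradsq_ge0 r f (x : cube n) : 0 <= gradsq r f x.
Proof. by apply: sumr_ge0 => j _; exact: sqr_ge0. Qed.

Lemma ravg_itv i f : (forall x : cube n, 0 <= f x <= 1) -> forall x : cube n, 0 <= ravg a i f x <= 1.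
Proof.
move=> f01 x; have /andP[? ?] := a01; rewrite /ravg.
by have /andP[? ?] := f01 (setc x i true); have /andP[? ?] := f01 (setc x i false); nra.
Qed.

(** The two-point inequality creates the derivative in direction i. Minkowski's inequality joins it
    to those already present, because averaging over coordinate i can only shrink the positive parts
    in the other directions. *)
Lemma J_step i r f (x : cube n) : (forall x : cube n, 0 <= f x <= 1) -> i \notin r ->
  Num.sqrt (J (ravg a i f x) ^+ 2 + c * gradsq r (ravg a i f) x) <=
  ravg a i (fun x => Num.sqrt (J (f x) ^+ 2 + c * gradsq (i :: r) f x)) x.
Proof.
move=> f01 ir; have /andP[a0 a1] := a01'.
set x1 := setc x i true; set x0 := setc x i false.
have fx1 : flip x1 i = x0 by apply/ffunP => j; rewrite !ffunE eqxx; case: (j == i).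
have fx0 : flip x0 i = x1 by apply/ffunP => j; rewrite !ffunE eqxx; case: (j == i).
have g1 y : Num.sqrt (J (f y) ^+ 2 + c * gradsq (i :: r) f y) =
    Num.sqrt (Num.sqrt (J (f y) ^+ 2 + c * pos (f y - f (flip y i)) ^+ 2) ^+ 2 +
      (Num.sqrt c * Num.sqrt (gradsq r f y)) ^+ 2).
  rewrite [(_ * Num.sqrt (gradsq _ _ _)) ^+ 2]exprMn !sqr_sqrtr ?gradsq_ge0 //; last first.
    by apply: addr_ge0; [exact: sqr_ge0|apply: mulr_ge0 => //; exact: sqr_ge0].
  by rewrite /gradsq big_cons mulrDr addrA.
have -> : c * gradsq r (ravg a i f) x = (Num.sqrt c * Num.sqrt (gradsq r (ravg a i f) x)) ^+ 2.
  by rewrite [RHS]exprMn !sqr_sqrtr ?gradsq_ge0.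
rewrite [X in _ <= X]/ravg -/x1 -/x0 !g1 fx1 fx0.
apply: mink2 => //; first by rewrite subr_ge0.
  have /andP[h0 _] := ravg_itv i f01 x.
  by rewrite J_ge0 //= /ravg; apply: J_two_points.
rewrite mulr_ge0 ?sqrtr_ge0 //= 2!(mulrCA _ (Num.sqrt c)) -mulrDr ler_wpM2l ?sqrtr_ge0 //.
rewrite /gradsq; apply: mink_seq => //; first by rewrite subr_ge0.
move=> j jr; rewrite pos_ge0 /=.
have ij : i != j by apply: contra ir => /eqP ->.
rewrite /x1 /x0 !flip_setc //; set y := flip x j.
apply: pos_le; first by rewrite addr_ge0 ?mulr_ge0 ?pos_ge0 // subr_ge0.
rewrite /ravg; apply: (@le_trans _ _ (a * (f (setc x i true) - f (setc y i true)) +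
  (1 - a) * (f (setc x i false) - f (setc y i false)))); first by lra.
by apply: lerD; apply: ler_wpM2l; rewrite ?le_pos // subr_ge0.
Qed.

Lemma J_tensor_seq r f : uniq r -> (forall x : cube n, 0 <= f x <= 1) ->
  Ex a (fun x => J (foldl (fun g i => ravg a i g) f r x)) <=
  Ex a (fun x => Num.sqrt (J (f x) ^+ 2 + c * gradsq r f x)).
Proof.
elim: r f => [|i r IH] f /=.
  move=> _ f01; apply: le_Ex => // x; rewrite /gradsq big_nil mulr0 addr0 sqrtr_sqr.
  exact: ler_norm.
move=> /andP[ir ur] f01; apply: le_trans (IH _ ur (ravg_itv i f01)) _.
rewrite -[leRHS](Ex_ravg a i); apply: le_Ex => // x.
exact: J_step.
Qed.

(** Each averaging keeps the mean, and a coordinate once averaged stays invariant under flips, so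
    the final function is constant. *)
Lemma foldl_ravg f x : foldl (fun g i => ravg a i g) f (enum 'I_n) x = Ex a f.
Proof.
set F := foldl _ _ _.
have FE : Ex a F = Ex a f.
  by rewrite /F; elim: (enum _) f {F} => //= i r IH g; rewrite IH Ex_ravg.
have Fc : forall i x, F (flip x i) = F x.
  move=> i y; rewrite /F; have : i \in enum 'I_n by rewrite mem_enum.
  have keep (r : seq 'I_n) (g : cube n -> R) : (forall z, g (flip z i) = g z) ->
      forall z, foldl (fun g i => ravg a i g) g r (flip z i) =
        foldl (fun g i => ravg a i g) g r z.
    elim: r g => //= j r IH g gi z; apply: IH => {}z.
    have [->|ij] := eqVneq i j; first exact: ravg_flip.
    by rewrite /ravg -!flip_setc 1?eq_sym // !gi.
  elim: (enum _) f {F FE} => //= j r IH g; rewrite inE => /predU1P[<-|/IH] //.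
  by apply: keep => z; exact: ravg_flip.
rewrite -FE -(Ex_cst a n (F x)); apply: eq_Ex => y.
exact: flip_invariant_const.
Qed.

Lemma J_isoperimetry f : (forall x : cube n, 0 <= f x <= 1) ->
  J (Ex a f) <=
  Ex a (fun x => Num.sqrt (J (f x) ^+ 2 + c * gradsq (enum 'I_n) f x)).
Proof.
move=> f01; apply: le_trans (J_tensor_seq (enum_uniq _) f01).
rewrite -{1}(Ex_cst a n (J (Ex a f))); apply: le_Ex => // x.
by rewrite foldl_ravg.
Qed.

End Tensorization.
End Isoperimetry.

(** * Dyadic slices and the entropy inequality *)

Section Dyadic.
Variable R : realType.
Implicit Types (s t lo hi : R) (k N : nat).

Definition slice lo hi s : R := Num.min s hi - Num.min s lo.
Definition lo k : R := if k is k'.+1 then 2 ^+ k' else 0.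
Definition hi k : R := 2 ^+ k.

Lemma hi_gt0 k : 0 < hi k. Proof. by rewrite exprn_gt0. Qed.

Lemma lo_ge0 k : 0 <= lo k. Proof. by case: k => //= k; rewrite exprn_ge0. Qed.

Lemma lo_lt_hi k : lo k < hi k.
Proof. by case: k => [|k] //=; rewrite /hi exprS; have := hi_gt0 k; rewrite /hi; lra. Qed.

Lemma minE s t : Num.min s t = if s <= t then s else t.
Proof. by case: lerP. Qed.

Ltac case_min := rewrite /slice !minE; repeat match goal with
  |- context [if ?x <= ?y then _ else _] => case: (lerP x y) => ? end.

Lemma slice_ge0 l h s : l <= h -> 0 <= slice l h s.
Proof. by move=> lh; case_min; lra. Qed.

Lemma slice_le l h s : l <= h -> slice l h s <= h - l.
Proof. by move=> lh; case_min; lra. Qed.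

Lemma slice_eq0 l h s : l <= h -> s <= l -> slice l h s = 0.
Proof. by move=> lh sl; case_min; lra. Qed.

Lemma slice_mono l h s t : l <= h -> s <= t -> slice l h s <= slice l h t.
Proof. by move=> lh st; case_min; lra. Qed.

Lemma slice_sat l h s t : l <= h -> h <= s -> s <= t -> slice l h s = slice l h t.
Proof. by move=> lh hs st; case_min; lra. Qed.

Definition slope l h s : R :=
  if s <= l then 0 else if s <= 2 * h then 1 else 2 * (h - l) / s.

Lemma slope_ge0 l h s : 0 <= l <= h -> 0 <= slope l h s.
Proof.
move=> /andP[l0 lh]; rewrite /slope; case: (lerP s l) => // ls; case: ifP => // _.
by rewrite divr_ge0 //; lra.
Qed.

Lemma slice_lip l h s t : 0 <= l < h ->
  pos (slice l h s - slice l h t) <= slope l h s * pos (s - t).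
Proof.
move=> /andP[l0 lh]; have lh' := ltW lh.
apply: pos_le; first by rewrite mulr_ge0 ?pos_ge0 // slope_ge0 // l0 ltW.
have [st|ts] := lerP s t.
  rewrite (@le0_pos _ (s - t)); last by lra.
  by rewrite mulr0 subr_le0 slice_mono.
rewrite ge0_pos; last by lra.
rewrite /slope; case: (lerP s l) => [sl|ls].
  by rewrite slice_eq0 // mul0r add0r oppr_le0 slice_ge0.
case: (lerP s (2 * h)) => [sh|hs].
  by rewrite mul1r; case_min; lra.
have [ht|th] := lerP h t.
  rewrite (@slice_sat l h t s) //; last by lra.
  by rewrite subrr mulr_ge0 ?divr_ge0 //; lra.
apply: (@le_trans _ _ (h - l)); first by have := slice_le s lh'; have := slice_ge0 t lh'; lra.
rewrite mulrAC ler_pdivlMr; last by lra.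
rewrite -mulrA mulrCA; apply: ler_wpM2l; lra.
Qed.

(* Far above its band a slice moves only if v drops by half of its value, so the
   slopes decay geometrically and the sliced gradients add up to at most 4 gradients. *)
Lemma sum_slope N s : \sum_(k < N) slope (lo k) (hi k) s <= 4.
Proof.
(* The induction records where s lies. Above the bands summed so far the slopes have a geometric
   bound below 2; the slope is 1 only for [lo < s <= 2 * hi], that is for at most two consecutive
   bands, whence 3 and then 4. *)
suff : \sum_(k < N) slope (lo k) (hi k) s <=
    if hi N < s then 2 * hi N / s else if lo N < s then 3 else 4.
  move=> /le_trans; apply; case: ifP => [hs|_]; last by case: ifP => _; lra.
  by have h0 := hi_gt0 N; rewrite ler_pdivrMr; lra.
elim: N => [|N IH].
  rewrite big_ord0; case: ifP => [hs|_]; last by case: ifP => _; lra.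
  by rewrite divr_ge0 // /hi; move: hs; rewrite /hi; lra.
rewrite big_ord_recr /=; apply: (le_trans (lerD IH (lexx _))) => {IH}.
have h0 := hi_gt0 N; have hS : hi N.+1 = 2 * hi N by rewrite /hi exprS.
have lh := lo_lt_hi N; have l0 := lo_ge0 N.
rewrite hS -/(hi N) /slope.
have [hs|sh] := ltrP (hi N) s.
  rewrite (lt_geF (lt_trans lh hs)).
  have [hs2|sh2] := ltrP (2 * hi N) s.
    by rewrite -mulrDl ler_pdivrMr; last lra; rewrite divfK ?gt_eqF; lra.
  rewrite -lerBrDr ler_pdivrMr; lra.
have -> : (2 * hi N < s) = false by apply/negbTE; rewrite -leNgt; lra.
have [ls|sl] := ltrP (lo N) s; last by rewrite addr0.
by case: ifP; lra.
Qed.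

Lemma sum_slice N s : 0 <= s -> \sum_(k < N) slice (lo k) (hi k) s = Num.min s (lo N).
Proof.
move=> s0; elim: N => [|N IH]; first by rewrite big_ord0; apply/esym/min_idPr.
by rewrite big_ord_recr /= IH /slice addrC subrK.
Qed.

(** The widths telescope to [hi k] for the last band with [lo k < s]. There
    [hi k = 2 * lo k < 2 * s], except in the bottom band [0, 1], which yields the indicator. *)
Lemma sum_levels N s : 0 <= s ->
  \sum_(k < N) (hi k - lo k) * (lo k < s)%R%:R <= (0 < s)%R%:R + 2 * s.
Proof.
move=> s0.
suff [] : \sum_(k < N) (hi k - lo k) * (lo k < s)%R%:R <= lo N /\
    \sum_(k < N) (hi k - lo k) * (lo k < s)%R%:R <= (0 < s)%R%:R + 2 * s by [].
elim: N => [|N [IH1 IH2]]; first by rewrite big_ord0 addr_ge0 ?mulr_ge0.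
rewrite big_ord_recr /=.
have lh := lo_lt_hi N; have l0 := lo_ge0 N.
case: (ltrP (lo N) s) => ls; rewrite ?mulr1 ?mulr0 ?addr0; last first.
  by rewrite -/(hi N); split; lra.
rewrite -/(hi N); split; first by lra.
case: N {l0} IH1 IH2 ls lh => [|N] IH1 IH2 /= ls lh.
  by rewrite big_ord0 ls /hi expr0 mulr1n; lra.
by move: IH1 => /=; rewrite {3}/hi exprS; have := ler0n R (0 < s)%R; lra.
Qed.

End Dyadic.

(** * Entropy inequality for functions of small support *)

Section Entropy.
Variable R : realType.
Variables (a k : R).
Hypotheses (a01 : 0 < a < 1) (ak : a^-1 <= k) (bk : (1 - a)^-1 <= k).
Variable n : nat.
Implicit Types (v : cube n -> R).

Let c := 2 * k + k ^+ 2.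

Let a01' : 0 <= a <= 1. Proof. by have /andP[? ?] := a01; rewrite !ltW. Qed.

Let k0 : 0 <= k.
Proof. by apply: le_trans ak; rewrite invr_ge0; move/andP: a01'=> []. Qed.

Let c0 : 0 <= c. Proof. by rewrite addr_ge0 ?mulr_ge0 ?sqr_ge0. Qed.

Definition grad v x : R := Num.sqrt (gradsq (enum 'I_n) v x).

Lemma grad_ge0 v x : 0 <= grad v x. Proof. exact: sqrtr_ge0. Qed.

Lemma le_grad v w x (d : R) : 0 <= d ->
  (forall y, pos (v x - v y) <= d * pos (w x - w y)) -> grad v x <= d * grad w x.
Proof.
move=> d0 vw; rewrite /grad -[X in _ <= X * _](ger0_norm d0) -sqrtr_sqr -sqrtrM ?sqr_ge0 //.
apply: ler_wsqrtr; rewrite /gradsq mulr_sumr; apply: ler_sum => j _.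
by rewrite -exprMn lerXn2r ?nnegrE ?mulr_ge0 ?pos_ge0.
Qed.

Lemma sqrt_le_add (x y : R) : 0 <= x -> 0 <= y -> Num.sqrt (x + y) <= Num.sqrt x + Num.sqrt y.
Proof.
move=> x0 y0; rewrite -[leRHS]ger0_norm ?addr_ge0 ?sqrtr_ge0 // -sqrtr_sqr ler_wsqrtr //.
rewrite sqrrD !sqr_sqrtr //.
have : 0 <= Num.sqrt x * Num.sqrt y by rewrite mulr_ge0 ?sqrtr_ge0.
lra.
Qed.

(* The error term only sees the level set {v > l} because J <= 3 on [0, 1]. *)
Lemma level_ineq v (l h : R) : 0 <= l < h ->
  Ex a (fun x => slice l h (v x)) *
    Num.sqrt (ln (8 / (Ex a (fun x => slice l h (v x)) / (h - l)))) <=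
  3 * ((h - l) * Ex a (fun x => (l < v x)%R%:R)) +
  Num.sqrt c * Ex a (fun x => slope l h (v x) * grad v x).
Proof.
move=> /andP[l0 lh]; have lh' := ltW lh; set P := slice l h.
set d := h - l; have d0 : 0 < d by rewrite /d; lra.
pose F x := P (v x) / d.
have F01 x : 0 <= F x <= 1.
  apply/andP; split; first by rewrite /F divr_ge0 ?slice_ge0 // ltW.
  by rewrite ler_pdivrMr // mul1r slice_le.
have EF : Ex a (fun x => P (v x)) = d * Ex a F.
  by rewrite -ExZ; apply: eq_Ex => x; rewrite /F mulrC divfK ?gt_eqF.
have -> : Ex a (fun x => P (v x)) / d = Ex a F by rewrite EF mulrC mulKf ?gt_eqF.
rewrite EF -mulrA -/(J (Ex a F)).
apply: (@le_trans _ _ (d * Ex a (fun x => 3 * (l < v x)%R%:R +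
    Num.sqrt c * (d^-1 * (slope l h (v x) * grad v x))))); last first.
  by rewrite ExD !ExZ mulrDr; rewrite mulrCA [d * (_ * (d^-1 * _))]mulrCA mulVKf // gt_eqF.
apply: ler_wpM2l; first exact: ltW.
apply: le_trans (J_isoperimetry a01 ak bk F01) _; apply: le_Ex => // x.
apply: le_trans (sqrt_le_add _ _) _; rewrite ?sqr_ge0 ?mulr_ge0 ?gradsq_ge0 //.
rewrite sqrtr_sqr sqrtrM // ger0_norm ?J_ge0 //; last by have /andP[] := F01 x.
apply: lerD.
  case: (ltrP l (v x)) => lv; first by rewrite mulr1; apply: J_le3.
  by rewrite mulr0 /F /P slice_eq0 // mul0r J0.
apply: ler_wpM2l; first exact: sqrtr_ge0.
rewrite mulrA; apply: le_grad.
  by apply: mulr_ge0; [rewrite invr_ge0 ltW|rewrite slope_ge0 // l0].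
move=> y; rewrite -mulrA /F.
apply: (@le_trans _ _ (d^-1 * pos (P (v x) - P (v y)))); last first.
  by apply: ler_wpM2l; [rewrite invr_ge0 ltW|apply: slice_lip; rewrite l0].
apply: pos_le; first by rewrite mulr_ge0 ?pos_ge0 ?invr_ge0 ?ltW.
by rewrite -mulrBl mulrC; apply: ler_wpM2l; [rewrite invr_ge0 ltW|exact: le_pos].
Qed.

(* The support must be small enough for sqrt(ln (8 / eta0)) >= 12 to absorb the
   error terms of level_ineq summed over all slices. *)
Definition eta0 : R := expR (- 144) / 48.

Lemma eta0_gt0 : 0 < eta0. Proof. by rewrite divr_gt0 ?expR_gt0. Qed.

Lemma ln_eta0 : 144 <= ln (8 / eta0).
Proof.
rewrite -[leLHS]expRK ler_ln ?posrE ?expR_gt0 ?divr_gt0 ?eta0_gt0 //.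
rewrite /eta0 invf_div mulrA -expRN opprK; have := expR_gt0 (144 : R); lra.
Qed.

(** Origin of the denominator 48: the support term enters [entropy_ineq] with the factor 12. *)
Lemma eta0_small : 12 * eta0 <= 1 / 4.
Proof. by rewrite /eta0; have : expR (- 144) <= 1 :> R; [rewrite expR_le1; lra|lra]. Qed.

(** By Markov, {v > lo j} has measure at most 1 / max(1, lo j) when E v <= 1, so [level_ineq] offers
    slice j at least this much. *)
Let lam j : R := Num.sqrt (ln (8 * Num.max 1 (lo R j))).

Lemma markov v (m : R) : (forall x, 0 <= v x) -> 0 <= m ->
  m * Ex a (fun x => (m < v x)%R%:R) <= Ex a v.
Proof.
move=> v0 m0; rewrite -ExZ; apply: le_Ex => // x.
by case: ltrP => h; rewrite ?mulr1 ?mulr0 // ltW.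
Qed.

(** Half of s = v x is the sum of slice(s) - slice(s / 2), and only bands with hi > s / 2
    contribute. There s < 4 max(1, lo) and e <= 4 max(1, lo), so e + s stays below the argument 8
    max(1, lo) of the logarithm in [lam]. *)
Lemma sum_lam v N x : (forall x, 0 <= v x) -> v x <= lo R N ->
  v x / 2 * Num.sqrt (ln (expR 1 + v x)) <=
  \sum_(j < N) slice (lo R j) (hi R j) (v x) * lam j.
Proof.
move=> v0 vN; set s := v x in vN *; have s0 : 0 <= s by exact: v0.
have -> : s / 2 = \sum_(j < N) (slice (lo R j) (hi R j) s - slice (lo R j) (hi R j) (s / 2)).
  rewrite sumrB !sum_slice //; last by lra.
  by rewrite !minE vN; case: ifP; lra.
rewrite mulr_suml; apply: ler_sum => j _.
have lh := lo_lt_hi R j; have lh' := ltW lh; have l0 := lo_ge0 R j.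
have [hs|sh] := lerP (hi R j) (s / 2).
  rewrite (@slice_sat _ _ _ _ s lh' hs); last by lra.
  by rewrite subrr mul0r mulr_ge0 ?slice_ge0 ?sqrtr_ge0.
apply: ler_pM.
- by rewrite subr_ge0 slice_mono //; lra.
- exact: sqrtr_ge0.
- by rewrite lerBlDr lerDl slice_ge0.
have e0 := expR_gt0 (1 : R); have e4 := expR1_le4 R.
have m1 : 1 <= Num.max 1 (lo R j) by rewrite le_max lexx.
have m2 : hi R j <= 2 * Num.max 1 (lo R j).
  case: j {lh lh' l0} sh m1 => -[|j] jN /= sh m1; first by rewrite /hi expr0; lra.
  by rewrite /hi exprS ler_wpM2l // le_max lexx orbT.
by rewrite ler_wsqrtr // ler_ln ?posrE; lra.
Qed.

Lemma half_sum_le_sqrt (x y z : R) : x <= z -> y <= z ->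
  (Num.sqrt x + Num.sqrt y) / 2 <= Num.sqrt z.
Proof. by move=> /ler_wsqrtr xz /ler_wsqrtr yz; lra. Qed.

(** The logarithm in [level_ineq] is large for two reasons: small support ([L]) and Markov's
    inequality ([lam j]). Keeping the half-sum of both roots, the [L] half absorbs the term 6 E v
    coming from [sum_levels], and the [lam] half adds up to the entropy. *)
Lemma entropy_ineq v : (forall x, 0 <= v x) -> Ex a v <= 1 ->
  Ex a (fun x => (0 < v x)%R%:R) <= eta0 ->
  Ex a (fun x => v x * Num.sqrt (ln (expR 1 + v x))) <=
    1 / 4 + 16 * Num.sqrt c * Ex a (grad v).
Proof.
move=> v0 v1 veta.
have [N vN] : exists N, forall x, v x <= lo R N.
  pose N := Num.truncn (\sum_x v x); exists N.+1 => x.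
  apply: (@le_trans _ _ (\sum_x v x)).
    by rewrite (bigD1 x) //= lerDl sumr_ge0.
  have /andP[_ /ltW h] : N%:R <= \sum_x v x < N.+1%:R by rewrite truncn_itv ?sumr_ge0.
  apply: le_trans h _; rewrite /= -natrX ler_nat; exact: ltn_expl.
pose T j x := slice (lo R j) (hi R j) (v x).
have T0 j : 0 <= Ex a (T j) by apply: Ex_ge0 => // x; rewrite slice_ge0 ?ltW ?lo_lt_hi.
pose L := Num.sqrt (ln (8 / eta0)).
have L12 : 12 <= L.
  by rewrite -[leLHS]ger0_norm // -sqrtr_sqr ler_wsqrtr //; have := ln_eta0; lra.
have lev j : Ex a (T j) * ((L + lam j) / 2) <=
    3 * ((hi R j - lo R j) * Ex a (fun x => (lo R j < v x)%R%:R)) +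
    Num.sqrt c * Ex a (fun x => slope (lo R j) (hi R j) (v x) * grad v x).
  have lh := lo_lt_hi R j; have l0 := lo_ge0 R j.
  have l0h : 0 <= lo R j < hi R j by rewrite l0.
  apply: le_trans (level_ineq v l0h); rewrite /= -/(T j).
  move: (T0 j); rewrite le_eqVlt => /predU1P[<-|Tj0]; first by rewrite !mul0r.
  apply: ler_wpM2l; first exact: ltW.
  set d := hi R j - lo R j; have d0 : 0 < d by rewrite /d; lra.
  set e := Ex a (T j) / d.
  have e0 : 0 < e by rewrite divr_gt0.
  have eP : e <= Ex a (fun x => (lo R j < v x)%R%:R).
    rewrite ler_pdivrMr // mulrC -ExZ; apply: le_Ex => // x.
    case: (ltrP (lo R j) (v x)) => lv; first by rewrite mulr1 slice_le ?ltW.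
    by rewrite mulr0 /T slice_eq0 // ltW.
  have eE : e <= eta0.
    apply: le_trans eP (le_trans _ veta); apply: le_Ex => // x.
    by case: (ltrP (lo R j)) => // lv; rewrite (le_lt_trans l0 lv).
  have eM : e * Num.max 1 (lo R j) <= 1.
    have [_|_] := lerP (lo R j) 1.
      rewrite mulr1; apply: le_trans eP _; rewrite -[leRHS](Ex_cst a n 1).
      by apply: le_Ex => // x; case: ltrP.
    rewrite mulrC; apply: le_trans v1; apply: le_trans (markov v0 l0).
    by rewrite ler_wpM2l.
  have m1 : 1 <= Num.max 1 (lo R j) by rewrite le_max lexx.
  have inv8 (x y : R) : 0 < x -> 0 < y -> x <= y -> ln (8 / y) <= ln (8 / x).
    move=> x0 y0 xy; rewrite ler_ln ?posrE ?divr_gt0 // ler_wpM2l //.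
    by rewrite lef_pV2 ?posrE.
  apply: half_sum_le_sqrt; first by apply: inv8; rewrite ?eta0_gt0.
  have -> : Num.max 1 (lo R j) = (Num.max 1 (lo R j))^-1^-1 by rewrite invrK.
  apply: inv8 => //; first by rewrite invr_gt0; lra.
  by rewrite -div1r ler_pdivlMr //; lra.
have sumT : Ex a v = \sum_(j < N) Ex a (T j).
  rewrite -Ex_sum; apply: eq_Ex => x.
  by rewrite sum_slice // minE vN.
have := ler_sum (index_enum 'I_N) (P := xpredT) (fun j _ => lev j).
rewrite big_split /= -!mulr_sumr => main.
have R1 : \sum_(j < N) (hi R j - lo R j) * Ex a (fun x => (lo R j < v x)%R%:R) <=
    eta0 + 2 * Ex a v.
  under eq_bigr do rewrite -ExZ.
  rewrite -Ex_sum; apply: (@le_trans _ _ (Ex a (fun x => (0 < v x)%R%:R + 2 * v x))).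
    by apply: le_Ex => // x; exact: sum_levels.
  by rewrite ExD ExZ lerD2r.
have R2 : \sum_(j < N) Ex a (fun x => slope (lo R j) (hi R j) (v x) * grad v x) <=
    4 * Ex a (grad v).
  rewrite -Ex_sum -ExZ; apply: le_Ex => // x; rewrite -mulr_suml.
  by apply: ler_wpM2r; [exact: grad_ge0|exact: sum_slope].
have R3 : Ex a (fun x => v x * Num.sqrt (ln (expR 1 + v x))) <=
    2 * \sum_(j < N) Ex a (T j) * lam j.
  under eq_bigr do rewrite mulrC -ExZ.
  rewrite -Ex_sum -ExZ; apply: le_Ex => // x.
  have := sum_lam v0 (vN x).
  under eq_bigr do rewrite mulrC.
  rewrite /T; lra.
have R4 : \sum_(j < N) Ex a (T j) * ((L + lam j) / 2) =
    L / 2 * Ex a v + (\sum_(j < N) Ex a (T j) * lam j) / 2.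
  rewrite sumT mulr_sumr mulr_suml -big_split /=; apply: eq_bigr => j _; lra.
rewrite R4 in main.
have Ev0 : 0 <= Ex a v by apply: Ex_ge0.
have R5 := ler_wpM2l (sqrtr_ge0 c) R2.
have R6 : 6 * Ex a v <= L / 2 * Ex a v by apply: ler_wpM2r => //; lra.
have := eta0_small.
lra.
Qed.

End Entropy.

(** * From L_1 to L_p *)

Section PowerInequalities.
Variable R : realType.
Implicit Types (x y q : R).

Lemma le_powR q x y : 0 <= q -> 0 <= x -> x <= y -> x `^ q <= y `^ q.
Proof. by move=> q0 x0 xy; apply: ge0_ler_powR; rewrite ?nnegrE // (le_trans x0). Qed.

Lemma powR_le1 q x : 0 <= q -> 0 <= x -> x <= 1 -> x `^ q <= 1.
Proof. by move=> q0 x0 x1; have := le_powR q0 x0 x1; rewrite powR1. Qed.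

End PowerInequalities.

(** * The Orlicz function [Phi] and passage to p-th powers *)

Section PowerEntropy.
Variable R : realType.
Implicit Types (s t y : R).

(** Concavity of ln between e and e + x, written with the tangent at y = e + m x; the term (1 - m)
    ln e is nonnegative and dropped. *)
Lemma ln_scale (m x : R) : 0 <= m <= 1 -> 0 <= x ->
  m * ln (expR 1 + x) <= ln (expR 1 + m * x).
Proof.
move=> /andP[m0 m1] x0; have e0 := expR_gt0 (1 : R).
set y := expR 1 + m * x; have y0 : 0 < y by rewrite /y ltr_pwDl // mulr_ge0.
have tangent z : 0 < z -> ln z <= ln y + (z / y - 1).
  move=> z0; rewrite -lerBlDl -ln_div ?posrE //; apply: ln_le_sub1; exact: divr_gt0.
have h1 := ler_wpM2l m0 (tangent (expR 1 + x) (ltr_wpDr x0 e0)).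
have m1' : 0 <= 1 - m by lra.
have h2 := ler_wpM2l m1' (tangent _ e0).
have h3 : m * ((expR 1 + x) / y - 1) + (1 - m) * (expR 1 / y - 1) = 0.
  by rewrite /y; field; rewrite gt_eqF.
move: h2; rewrite expRK => h2; lra.
Qed.

(** Bernoulli's inequality for real exponents, read off Young's inequality for the product m * 1. *)
Lemma bernoulli_powR (m r : R) : 0 <= m -> 1 <= r -> 1 - r * (1 - m) <= m `^ r.
Proof.
move=> m0; rewrite le_eqVlt => /predU1P[<-|r1]; first by rewrite powRr1 //; lra.
have r0 : 0 < r by lra.
have q0 : 0 < r / (r - 1) by rewrite divr_gt0 //; lra.
have := @conjugate_powR R m 1 r (r / (r - 1)) m0 ler01 r0 q0.
rewrite invf_div powR1 !mulr1 mul1r => /(_ _) h.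
have : m <= m `^ r / r + (r - 1) / r by apply: h; field; rewrite gt_eqF.
by rewrite -mulrDl ler_pdivlMr //; lra.
Qed.

Variable p : R.
Hypothesis p1 : 1 <= p.

Let p0 : 0 < p. Proof. by apply: lt_le_trans p1. Qed.

Definition slog s : R := Num.sqrt (ln (expR 1 + s `^ p)).
Definition Phi s : R := (s * slog s) `^ p.

Lemma PhiE s : 0 <= s -> Phi s = s `^ p * ln (expR 1 + s `^ p) `^ (p / 2).
Proof.
move=> s0; rewrite /Phi powRM ?sqrtr_ge0 // /slog -powR12_sqrt.
  by rewrite -powRrM [2^-1 * p]mulrC.
by rewrite ln_ge0 // ler_wpDr ?powR_ge0 //; have := @expR_ge1Dx R 1; lra.
Qed.

Lemma ln_ge1 x : 0 <= x -> 1 <= ln (expR 1 + x) :> R.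
Proof.
by move=> x0; rewrite -[leLHS]expRK ler_ln ?posrE ?expR_gt0 ?ltr_wpDr ?expR_gt0 // lerDl.
Qed.

Lemma slog_ge1 s : 1 <= slog s.
Proof. by rewrite -[leLHS]sqrtr1 ler_wsqrtr // ln_ge1 // powR_ge0. Qed.

Lemma slog_ge0 s : 0 <= slog s. Proof. exact: sqrtr_ge0. Qed.

Lemma slog_mono s t : 0 <= s <= t -> slog s <= slog t.
Proof.
move=> /andP[s0 st]; rewrite ler_wsqrtr // ler_ln ?posrE ?ltr_wpDr ?powR_ge0 ?expR_gt0 //.
by rewrite lerD2l le_powR ?(ltW p0) // (le_trans s0).
Qed.

Lemma mul_slog_mono s t : 0 <= s <= t -> s * slog s <= t * slog t.
Proof.
by move=> st; have /andP[s0 st'] := st; apply: ler_pM; rewrite ?slog_ge0 ?slog_mono.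
Qed.

Lemma slog_scale m s : 0 < m <= 1 -> 0 <= s -> m `^ (p / 2) * slog s <= slog (m * s).
Proof.
move=> /andP[m0 m1] s0; have m0' := ltW m0.
have -> : m `^ (p / 2) = Num.sqrt (m `^ p) by rewrite -powR12_sqrt ?powR_ge0 // -powRrM.
rewrite /slog -sqrtrM ?powR_ge0 // ler_wsqrtr // powRM //.
apply: ln_scale; rewrite ?powR_ge0 //=.
by apply: powR_le1 => //; exact: ltW.
Qed.

Lemma Phi_ge0 s : 0 <= Phi s. Proof. exact: powR_ge0. Qed.

Lemma Phi_mono s t : 0 <= s <= t -> Phi s <= Phi t.
Proof.
move=> st; have /andP[s0 st'] := st.
apply: le_powR; rewrite ?(ltW p0) ?mulr_ge0 ?slog_ge0 //.
exact: mul_slog_mono.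
Qed.

Lemma Phi_scale m s : 0 <= m <= 1 -> 0 <= s -> Phi (m * s) <= m * Phi s.
Proof.
move=> /andP[m0 m1] s0.
apply: (@le_trans _ _ ((m * (s * slog s)) `^ p)).
  rewrite le_powR ?(ltW p0) ?mulr_ge0 ?slog_ge0 //.
  rewrite -mulrA; apply: ler_wpM2l => //; apply: ler_wpM2l => //.
  by apply: slog_mono; rewrite mulr_ge0 //= ler_piMl.
rewrite powRM ?mulr_ge0 ?slog_ge0 //; apply: ler_wpM2r; first exact: powR_ge0.
move: m0; rewrite le_eqVlt => /predU1P[<-|m0]; first by rewrite powR0 // gt_eqF.
by rewrite ge1r_powR // m0.
Qed.

Lemma powR_le_Phi s : 0 <= s -> s `^ p <= Phi s.
Proof.
move=> s0; rewrite le_powR ?(ltW p0) ?mulr_ge0 ?slog_ge0 //.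
by rewrite ler_peMr // slog_ge1.
Qed.

(* Psi is chosen so that Psi s * slog s = Phi s while its derivative is of order
   (s * slog s)^(p - 1). *)
Definition Psi s : R := s * (s * slog s) `^ (p - 1).
Definition Psi_exp : R := 1 + (1 + p / 2) * (p - 1).

Let pm0 : 0 <= p - 1. Proof. by rewrite subr_ge0. Qed.

Lemma Psi_exp_ge1 : 1 <= Psi_exp.
Proof. by rewrite /Psi_exp lerDl mulr_ge0 // addr_ge0 ?divr_ge0 ?(ltW p0). Qed.

Lemma Psi_ge0 s : 0 <= s -> 0 <= Psi s.
Proof. by move=> s0; rewrite mulr_ge0 ?powR_ge0. Qed.

Lemma Psi_mono s t : 0 <= s <= t -> Psi s <= Psi t.
Proof.
move=> st; have /andP[s0 st'] := st; rewrite /Psi.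
apply: (ler_pM s0 (powR_ge0 _ _) st').
by rewrite le_powR ?mulr_ge0 ?slog_ge0 ?mul_slog_mono.
Qed.

Lemma powR_le_Psi s : 0 <= s -> s `^ p <= Psi s.
Proof.
move=> s0; rewrite -(mulr_powRB1 s0 p0); apply: ler_wpM2l => //.
by rewrite le_powR ?mulr_ge0 ?slog_ge0 // ler_peMr // slog_ge1.
Qed.

Lemma Psi_slog s : 0 <= s -> Psi s * slog s = Phi s.
Proof.
by move=> s0; rewrite /Phi -(mulr_powRB1 _ p0) ?mulr_ge0 ?slog_ge0 // /Psi mulrAC.
Qed.

Lemma Psi_le_Phi s : 0 <= s -> Psi s <= Phi s.
Proof. by move=> s0; rewrite -Psi_slog // ler_peMr ?Psi_ge0 // slog_ge1. Qed.

Lemma Phi_le_entropy s : 0 <= s -> Phi s <= Psi s * Num.sqrt (ln (expR 1 + Psi s)).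
Proof.
move=> s0; rewrite -Psi_slog //; apply: ler_wpM2l; first exact: Psi_ge0.
rewrite ler_wsqrtr // ler_ln ?posrE ?ltr_wpDr ?powR_ge0 ?Psi_ge0 ?expR_gt0 //.
by rewrite lerD2l powR_le_Psi.
Qed.

Lemma Psi_scale m s : 0 < m <= 1 -> 0 <= s -> m `^ Psi_exp * Psi s <= Psi (m * s).
Proof.
move=> m01 s0; have /andP[m0 m1] := m01; have m0' := ltW m0.
have mn0 : m != 0 by rewrite gt_eqF.
rewrite /Psi_exp powRD ?mn0 ?implybT // powRr1 // powRrM /Psi.
have -> (x y : R) : m * x * (s * y) = m * s * (x * y) by ring.
rewrite -powRM ?powR_ge0 ?mulr_ge0 ?slog_ge0 //.
apply: ler_wpM2l; first by rewrite mulr_ge0.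
rewrite le_powR ?mulr_ge0 ?powR_ge0 ?slog_ge0 //.
rewrite powRD ?mn0 ?implybT // powRr1 //.
have -> : m * m `^ (p / 2) * (s * slog s) = m * s * (m `^ (p / 2) * slog s) by ring.
by apply: ler_wpM2l; [rewrite mulr_ge0|exact: slog_scale].
Qed.

(** A chain rule without derivatives: [Psi_scale] at m = t / s bounds Psi t below by a power of m
    times Psi s, and Bernoulli's inequality makes that power affine in t. *)
Lemma Psi_lip s t : 0 <= s -> 0 <= t ->
  pos (Psi s - Psi t) <= Psi_exp * (s * slog s) `^ (p - 1) * pos (s - t).
Proof.
move=> s0 t0; have V1 := Psi_exp_ge1.
have c0 : 0 <= Psi_exp * (s * slog s) `^ (p - 1) by rewrite mulr_ge0 ?powR_ge0 //; lra.
apply: pos_le; first by rewrite mulr_ge0 ?pos_ge0.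
have [st|ts] := lerP s t.
  rewrite (@le0_pos _ (s - t)); last by lra.
  by rewrite mulr0 subr_le0 Psi_mono // s0.
rewrite ge0_pos; last by lra.
have s0' : 0 < s by lra.
set Q := (s * slog s) `^ (p - 1) in c0 *.
have VE : Psi s = s * Q by [].
have Q0 : 0 <= Q by exact: powR_ge0.
suff : (1 - Psi_exp * (1 - t / s)) * Psi s <= Psi t.
  have -> : (1 - Psi_exp * (1 - t / s)) * Psi s = Psi s - Psi_exp * Q * (s - t).
    by rewrite VE; field; rewrite gt_eqF.
  by rewrite !lerBlDr addrC.
have V0 := Psi_ge0 s0.
move: t0; rewrite le_eqVlt => /predU1P[<-|t0].
  rewrite mul0r subr0 mulr1 /Psi !mul0r; apply: mulr_le0_ge0 => //; lra.
have m01 : 0 < t / s <= 1 by rewrite divr_gt0 //= ler_pdivrMr // mul1r ltW.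
have e : t / s * s = t by rewrite divfK // gt_eqF.
have := Psi_scale m01 s0; rewrite e; apply: le_trans; apply: ler_wpM2r => //.
by apply: bernoulli_powR => //; rewrite divr_ge0 ?ltW.
Qed.

(** If N <= e y the first term suffices; otherwise y < N / e and the second does. *)
Lemma young_powR (e y N : R) : 0 < e -> 0 <= y -> 0 <= N ->
  y `^ (p - 1) * N <= e * y `^ p + e^-1 `^ (p - 1) * N `^ p.
Proof.
move=> e0 y0 N0; have [Ny|yN] := lerP N (e * y).
  apply: (@le_trans _ _ (y `^ (p - 1) * (e * y))); first by rewrite ler_wpM2l ?powR_ge0.
  rewrite mulrCA [_ * y]mulrC mulr_powRB1 // lerDl mulr_ge0 ?powR_ge0 //.
apply: (@le_trans _ _ ((e^-1 * N) `^ (p - 1) * N)).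
  apply: ler_wpM2r => //; rewrite le_powR ?mulr_ge0 ?invr_ge0 ?(ltW e0) //.
  by rewrite mulrC ler_pdivlMr // mulrC ltW.
rewrite powRM ?invr_ge0 ?(ltW e0) // -mulrA [_ * N]mulrC mulr_powRB1 // lerDr.
by rewrite mulr_ge0 ?powR_ge0 // ltW.
Qed.

Lemma continuous_powR y : 0 < y -> {for y, continuous (fun t => t `^ p)}.
Proof.
move=> y0; apply: differentiable_continuous; apply/derivable1_diffP.
by apply: derivable_powR; rewrite in_itv /= y0.
Qed.

Lemma cvg_powR (f : R -> R) y : {for y, continuous f} -> 0 < f y ->
  {for y, continuous (fun t => f t `^ p)}.
Proof.
move=> fy f0; apply: (@continuous_comp _ _ _ f (fun t => t `^ p)) => //.
exact: continuous_powR.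
Qed.

Lemma continuous_Phi y : 0 < y -> {for y, continuous Phi}.
Proof.
move=> y0; have e0 := expR_gt0 (1 : R).
have idc : {for y, continuous (fun t : R => t)} by [].
apply: cvg_powR; last by rewrite mulr_gt0 //; have := slog_ge1 y; lra.
apply: cvgM => //.
apply: (@continuous_comp _ _ _ (fun t => ln (expR 1 + t `^ p)) Num.sqrt); last first.
  exact: sqrt_continuous.
apply: (@continuous_comp _ _ _ (fun t => expR 1 + t `^ p) (@ln R)); last first.
  by apply: continuous_ln; rewrite ltr_wpDr ?powR_ge0.
by apply: cvgD; [exact: cvg_cst|exact: continuous_powR].
Qed.

Section OnCube.
Variables (a k : R).
Hypotheses (a01 : 0 < a < 1) (ak : a^-1 <= k) (bk : (1 - a)^-1 <= k).
Variable n : nat.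
Implicit Types (u w N : cube n -> R).

Let c := 2 * k + k ^+ 2.

Let a01' : 0 <= a <= 1. Proof. by have /andP[? ?] := a01; rewrite !ltW. Qed.

Let k0 : 0 < k.
Proof. by apply: lt_le_trans ak; rewrite invr_gt0; have /andP[] := a01. Qed.

Definition Kent : R := 16 * Num.sqrt (2 * k + k ^+ 2) * Psi_exp.
Definition Kpow : R := 8 * Kent * (4 * Kent) `^ (p - 1).

Lemma Kent_gt0 : 0 < Kent.
Proof.
have V0 : 0 < Psi_exp := lt_le_trans ltr01 Psi_exp_ge1.
by rewrite /Kent mulr_gt0 // mulr_gt0 // sqrtr_gt0 addr_gt0 ?mulr_gt0 ?exprn_gt0.
Qed.

Lemma Kpow_ge0 : 0 <= Kpow.
Proof. by rewrite /Kpow mulr_ge0 ?powR_ge0 // mulr_ge0 // ltW // Kent_gt0. Qed.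

Lemma Phi_half_core w N : (forall x, 0 <= w x) ->
  Ex a (fun x => (0 < w x)%R%:R) <= eta0 R -> (forall x, grad w x <= N x) ->
  Ex a (fun x => Phi (w x)) = 1 / 2 -> 1 <= Kpow * Ex a (fun x => N x `^ p).
Proof.
move=> w0 weta gN EP; have K0 := Kent_gt0.
have N0 x : 0 <= N x by apply: le_trans (gN x); exact: grad_ge0.
have V0 x : 0 <= Psi (w x) by exact: Psi_ge0.
have h1 : Ex a (fun x => Psi (w x)) <= 1.
  apply: (@le_trans _ _ (1 / 2)); last by lra.
  by rewrite -EP; apply: le_Ex => // x; exact: Psi_le_Phi.
have h2 : Ex a (fun x => (0 < Psi (w x))%R%:R) <= eta0 R.
  apply: le_trans weta; apply: le_Ex => // x; rewrite ler_nat.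
  move: (w0 x); rewrite le_eqVlt => /predU1P[<-|->]; first by rewrite /Psi mul0r ltxx.
  by case: (0 < _)%R.
have := entropy_ineq a01 ak bk V0 h1 h2.
have h3 : 1 / 2 <= Ex a (fun x => Psi (w x) * Num.sqrt (ln (expR 1 + Psi (w x)))).
  by rewrite -EP; apply: le_Ex => // x; exact: Phi_le_entropy.
(* With this e, Young's first term costs [Kent * e / 2 = 1 / 8]. Together with the 1/4 of
   [entropy_ineq] it leaves 1/8 of the assumed 1/2, and [Kpow] carries the compensating factor 8. *)
set e := (4 * Kent)^-1.
have e0 : 0 < e by rewrite invr_gt0 mulr_gt0.
have V1 := Psi_exp_ge1.
have h4 : Ex a (grad (fun x => Psi (w x))) <=
    Psi_exp * (e * (1 / 2) + e^-1 `^ (p - 1) * Ex a (fun x => N x `^ p)).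
  rewrite -EP -!ExZ -ExD -ExZ; apply: le_Ex => // x.
  apply: (@le_trans _ _ (Psi_exp * (w x * slog (w x)) `^ (p - 1) * grad w x)).
    apply: le_grad; first by rewrite mulr_ge0 ?powR_ge0 //; lra.
    by move=> y; exact: Psi_lip.
  rewrite -mulrA; apply: ler_wpM2l; first by lra.
  apply: (@le_trans _ _ ((w x * slog (w x)) `^ (p - 1) * N x)).
    by apply: ler_wpM2l; rewrite ?powR_ge0.
  by apply: young_powR; rewrite ?mulr_ge0 ?slog_ge0.
have h5 : 0 <= 16 * Num.sqrt c by rewrite mulr_ge0 ?sqrtr_ge0.
have h6 := ler_wpM2l h5 h4.
have h7 : 16 * Num.sqrt c * (Psi_exp * (e * (1 / 2) + e^-1 `^ (p - 1) * Ex a (fun x => N x `^ p)))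
    = 1 / 8 + Kpow / 8 * Ex a (fun x => N x `^ p).
  have eK : Kent * e = 1 / 4 by rewrite /e; field; rewrite gt_eqF.
  move: (Ex a _) => E.
  transitivity (Kent * e / 2 + Kent * (e^-1 `^ (p - 1) * E)).
    by rewrite /Kent -/c; move: (e^-1 `^ _) => Z; ring.
  by rewrite eK /Kpow /e invrK; field.
rewrite h7 in h6; rewrite -/c; lra.
Qed.

(* If the mean of Phi (u / g) exceeded 1/2, some larger scale would give exactly 1/2. *)
Lemma Phi_half u N (g : R) : (forall x, 0 <= u x) ->
  Ex a (fun x => (0 < u x)%R%:R) <= eta0 R -> (forall x, grad u x <= N x) ->
  0 < g -> Kpow * Ex a (fun x => N x `^ p) < g `^ p ->
  Ex a (fun x => Phi (u x / g)) <= 1 / 2.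
Proof.
move=> u0 ueta gN g0 Kg; rewrite leNgt; apply/negP => big.
have N0 x : 0 <= N x by apply: le_trans (gN x); exact: grad_ge0.
have ug0 x : 0 <= u x / g by rewrite divr_ge0 // ltW.
(* Scales are written as e^{-t}, so they stay positive and [continuous_Phi] applies wherever u x >
   0. *)
pose G (t : R) := Ex a (fun x => Phi (expR (- t) * (u x / g))).
have Gc : continuous G.
  have Gx x : continuous (fun t : R => mu a x * Phi (expR (- t) * (u x / g))).
    move=> t; apply: cvgM; first exact: cvg_cst.
    move: (ug0 x); rewrite le_eqVlt => /predU1P[<-|ux0].
      rewrite (_ : (fun _ => _) = cst (Phi 0)); last by apply/funext => y; rewrite mulr0.
      by rewrite mulr0; exact: cvg_cst.
    apply: (@continuous_comp _ _ _ (fun t => expR (- t) * (u x / g)) Phi); last first.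
      by apply: continuous_Phi; rewrite mulr_gt0 ?expR_gt0.
    apply: cvgM; last exact: cvg_cst.
    apply: (@continuous_comp _ _ _ (fun t : R => - t) (@expR R)); last exact: continuous_expR.
    by apply: (@cvgN _ R^o); exact: cvg_id.
  rewrite /G /Ex; elim: (index_enum _) => [|x r IH].
    rewrite (_ : (fun _ => _) = cst 0); last by apply/funext => t; rewrite big_nil.
    exact: cst_continuous.
  rewrite (_ : (fun _ => _) = (fun t : R => mu a x * Phi (expR (- t) * (u x / g)))
      \+ (fun t => \sum_(y <- r) mu a y * Phi (expR (- t) * (u y / g)))).
    by move=> t; apply: cvgD; [exact: Gx|exact: IH].
  by apply/funext => t; rewrite big_cons.
have G0 : G 0 = Ex a (fun x => Phi (u x / g)).
  by apply: eq_Ex => x; rewrite oppr0 expR0 mul1r.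
have Gle t : 0 <= t -> G t <= expR (- t) * G 0.
  move=> t0; have et : 0 <= expR (- t) <= 1 by rewrite expR_ge0 expR_le1 oppr_le0.
  rewrite G0 -ExZ; apply: (le_Ex a01') => x; exact: (Phi_scale et (ug0 x)).
have GE t : G t = Ex a (fun x => Phi (expR (- t) * (u x / g))) := erefl.
clearbody G.
(* Far enough for the intermediate value theorem: e^M >= 1 + 2 G 0 gives G M <= 1/2. *)
pose M := 2 * G 0.
have G0b : 1 / 2 < G 0 by rewrite G0.
have M0 : 0 <= M by rewrite /M; lra.
have GM : G M <= 1 / 2.
  apply: le_trans (Gle _ M0) _; rewrite expRN mulrC ler_pdivrMr ?expR_gt0 //.
  have := @expR_ge1Dx R M; rewrite /M; lra.
have [t] : exists2 t, t \in `[0, M] & G t = 1 / 2.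
  apply: IVT => //; first exact: continuous_subspaceT.
  by rewrite ge_min le_max GM (ltW G0b) orbT.
rewrite in_itv /= => /andP[t0 tM]; rewrite GE => Gt.
set s := expR (- t); have s0 : 0 < s by exact: expR_gt0.
have s1 : s <= 1 by rewrite expR_le1 oppr_le0.
have sg0 : 0 <= s / g by rewrite divr_ge0 // ltW.
have := @Phi_half_core (fun x => s * (u x / g)) (fun x => s / g * N x).
have h1 x : 0 <= s * (u x / g) by rewrite mulr_ge0 // ltW.
have h2 : Ex a (fun x => (0 < s * (u x / g))%R%:R) <= eta0 R.
  apply: le_trans ueta; apply: le_Ex => // x; rewrite ler_nat.
  move: (u0 x); rewrite le_eqVlt => /predU1P[<-|->]; first by rewrite mul0r mulr0 ltxx.
  by case: (0 < _)%R.
have h3 x : grad (fun x => s * (u x / g)) x <= s / g * N x.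
  apply: (@le_trans _ _ (s / g * grad u x)); last by apply: ler_wpM2l.
  apply: le_grad => // y; apply: pos_le; first by rewrite mulr_ge0 ?pos_ge0.
  have -> : s * (u x / g) - s * (u y / g) = s / g * (u x - u y) by ring.
  by apply: ler_wpM2l => //; exact: le_pos.
move=> /(_ h1 h2 h3 Gt); apply/negP; rewrite -ltNge.
have -> : Ex a (fun x => (s / g * N x) `^ p) = (s / g) `^ p * Ex a (fun x => N x `^ p).
  by rewrite -ExZ; apply: eq_Ex => x; rewrite powRM.
rewrite mulrCA powRM ?invr_ge0 ?(ltW s0) ?(ltW g0) //.
have gp : 0 < g `^ p by exact: powR_gt0.
have -> : g^-1 `^ p = (g `^ p)^-1 by rewrite -powR_inv1 ?(ltW g0) // -powRrM mulN1r powRN.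
apply: (@lt_le_trans _ _ (s `^ p / g `^ p * g `^ p)).
  by rewrite ltr_pM2l // divr_gt0 // powR_gt0.
rewrite divfK ?gt_eqF //.
by apply: powR_le1 => //; exact: ltW.
Qed.

End OnCube.
End PowerEntropy.

(** * Orlicz norm bounded by the gradient and the mean *)

Section Orlicz.
Variables (R : realType) (p : R).
Hypothesis p1 : 1 <= p.

Let p0 : 0 < p. Proof. by apply: lt_le_trans p1. Qed.

Lemma powR_div (x y : R) : 0 <= x -> 0 <= y -> (x / y) `^ p = x `^ p / y `^ p.
Proof.
by move=> x0 y0; rewrite powRM ?invr_ge0 // -[y^-1]powR_inv1 // -powRrM mulN1r powRN.
Qed.

Lemma powR_invK (x : R) : 0 <= x -> (x `^ p^-1) `^ p = x.
Proof. by move=> x0; rewrite -powRrM mulVf ?powRr1 // gt_eqF. Qed.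

Lemma orlicz_le (a : R) (X : normedModType R) n (g : cube n -> X) (c : R) : 0 < c ->
  Ex a (fun x => Phi p (`|g x| / c)) <= 1 -> orlicz p (p / 2) a g <= c.
Proof.
move=> c0 h; apply: ge_inf; first by exists 0 => y [/ltW].
split => //; rewrite (eq_bigr (fun x => mu a x * Phi p (`|g x| / c))) // => x _.
have gc0 : 0 <= `|g x| / c by rewrite divr_ge0 // ltW.
by rewrite (PhiE p gc0) powR_div // ltW.
Qed.

Variables (a k : R).
Hypotheses (a01 : 0 < a < 1) (ak : a^-1 <= k) (bk : (1 - a)^-1 <= k).
Variable n : nat.
Implicit Types (h N : cube n -> R).

Let a01' : 0 <= a <= 1. Proof. by have /andP[? ?] := a01; rewrite !ltW. Qed.

(** The [+ 1] gives the strict inequality demanded by [Phi_half]. *)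
Definition Korl : R := (Kpow p k + 1) `^ p^-1.
Definition Corl : R := 2 * Num.sqrt (ln (expR 1 + 1)) / eta0 R.

Lemma Korl_gt0 : 0 < Korl.
Proof. by rewrite powR_gt0 // ltr_wpDl // (Kpow_ge0 p1 a01 ak). Qed.

Lemma Corl_gt0 : 0 < Corl.
Proof.
have := @ln_ge1 R 1 ler01 => h.
by rewrite divr_gt0 ?eta0_gt0 // mulr_gt0 // sqrtr_gt0; lra.
Qed.

(** The argument is y = 1 / (2 Q) <= 1 with Q = sqrt(ln (e + 1)). Since y^p <= 1 for every p,
    [slog p y <= Q] and y slog y <= 1/2; the power p >= 1 only lowers it. Thus [Corl] is free of
    p. *)
Lemma Phi_small (B : R) : 0 < B -> Phi p (B / eta0 R / (Corl * B)) <= 1 / 2.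
Proof.
move=> B0; have s0 := eta0_gt0 R.
set Q : R := Num.sqrt (ln (expR 1 + 1)).
have Q1 : 1 <= Q by rewrite -[leLHS]sqrtr1 ler_wsqrtr // ln_ge1.
have Q0 : 0 < Q by apply: lt_le_trans Q1.
have -> : B / eta0 R / (Corl * B) = (2 * Q)^-1.
  by rewrite /Corl -/Q; field; rewrite !gt_eqF.
set y := (2 * Q)^-1.
have y0 : 0 <= y by rewrite invr_ge0 mulr_ge0 // ltW.
have y1 : y <= 1 by rewrite invf_le1 ?mulr_gt0 //; lra.
have yQ : y * slog p y <= 1 / 2.
  apply: (@le_trans _ _ (y * Q)); last first.
    have -> : y * Q = 1 / 2 by rewrite /y; field; rewrite gt_eqF.
    exact: lexx.
  apply: (ler_wpM2l y0); rewrite ler_wsqrtr // ler_ln ?posrE ?ltr_wpDr ?powR_ge0 ?expR_gt0 //.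
  by rewrite lerD2l; apply: powR_le1 => //; exact: ltW.
have h0 : 0 <= y * slog p y by rewrite mulr_ge0 ?slog_ge0.
have yQ' := yQ; apply: le_trans yQ; rewrite /Phi; move: h0; rewrite le_eqVlt => /predU1P[<-|h0].
  by rewrite powR0 // gt_eqF.
apply: ge1r_powR => //; rewrite h0 /=; lra.
Qed.

(** The cut at m = B / [eta0] gives h <= u + m with u of support at most [eta0]. The quotient (u +
    m) / (Korl A + Corl B) is at most the larger of u / (Korl A) and m / (Corl B), and each of these
    accounts for 1/2. *)
Lemma Phi_concentration h N (A B : R) : (forall x, 0 <= h x) ->
  (forall x, grad h x <= N x) -> 0 < A -> 0 < B ->
  Ex a (fun x => N x `^ p) <= A `^ p -> Ex a h <= B ->
  Ex a (fun x => Phi p (h x / (Korl * A + Corl * B))) <= 1.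
Proof.
move=> h0 hN A0 B0 NA hB; have s0 := eta0_gt0 R.
have K0 := Korl_gt0; have C0 := Corl_gt0.
have KA : 0 < Korl * A by rewrite mulr_gt0.
have CB : 0 < Corl * B by rewrite mulr_gt0.
set m := B / eta0 R; have m0 : 0 < m by rewrite divr_gt0.
pose u x := pos (h x - m).
have u0 x : 0 <= u x by exact: pos_ge0.
have uh x : h x <= u x + m by have := le_pos (h x - m); rewrite /u; lra.
have um : Ex a (fun x => (0 < u x)%R%:R) <= eta0 R.
  have e : Ex a (fun x => (0 < u x)%R%:R) = Ex a (fun x => (m < h x)%R%:R).
    by apply: eq_Ex => x; rewrite /u /pos lt_max ltxx orbF subr_gt0.
  have := markov a01 h0 (ltW m0); rewrite e => mk.
  rewrite -(ler_pM2l m0); apply: le_trans mk (le_trans hB _).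
  by rewrite /m divfK // gt_eqF.
have uN x : grad u x <= N x.
  apply: le_trans (hN x); rewrite -[leRHS]mul1r; apply: le_grad => // y.
  rewrite mul1r /u; apply: pos_le; first exact: pos_ge0.
  have [hm|mh] := lerP (h x) m.
    rewrite (@le0_pos _ (h x - m)); last by lra.
    by have := pos_ge0 (h y - m); have := pos_ge0 (h x - h y); lra.
  rewrite (@ge0_pos _ (h x - m)); last by lra.
  by have := le_pos (h y - m); have := le_pos (h x - h y); lra.
have Kp : Kpow p k * Ex a (fun x => N x `^ p) < (Korl * A) `^ p.
  have Kp0 := Kpow_ge0 p1 a01 ak.
  rewrite powRM ?(ltW K0) ?(ltW A0) // /Korl powR_invK; last by rewrite addr_ge0.
  apply: (@le_lt_trans _ _ (Kpow p k * A `^ p)); first exact: ler_wpM2l.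
  by rewrite ltr_pM2r ?powR_gt0 // ltrDl.
have half := Phi_half p1 a01 ak bk u0 um uN KA Kp.
have e1 : 1 = 1 / 2 + 1 / 2 :> R by lra.
rewrite e1; apply: le_trans (lerD half (Phi_small B0)).
rewrite -[Phi p (B / _ / _)](Ex_cst a n) -ExD; apply: (le_Ex a01') => x.
have q0 : 0 <= h x / (Korl * A + Corl * B) by rewrite divr_ge0 // addr_ge0 ?ltW.
have D0 : 0 < Korl * A + Corl * B by rewrite addr_gt0.
have [um1|um1] := lerP (u x / (Korl * A)) (m / (Corl * B)).
  apply: (@le_trans _ _ (Phi p (m / (Corl * B)))); last by rewrite lerDr Phi_ge0.
  apply: (Phi_mono p1); rewrite q0 /= ler_pdivrMr //.
  have -> : m / (Corl * B) * (Korl * A + Corl * B) = m / (Corl * B) * (Korl * A) + m.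
    by rewrite mulrDr divfK // gt_eqF.
  apply: le_trans (uh x) _; rewrite lerD2r.
  by rewrite -ler_pdivrMr.
apply: (@le_trans _ _ (Phi p (u x / (Korl * A)))); last by rewrite lerDl Phi_ge0.
apply: (Phi_mono p1); rewrite q0 /= ler_pdivrMr //.
have -> : u x / (Korl * A) * (Korl * A + Corl * B) = u x + u x / (Korl * A) * (Corl * B).
  by rewrite mulrDr divfK // gt_eqF.
apply: le_trans (uh x) _; rewrite lerD2l.
by rewrite -ler_pdivrMr // ltW.
Qed.

Lemma orlicz_concentration (X : normedModType R) (g : cube n -> X) N :
  (forall x, grad (fun x => `|g x|) x <= N x) ->
  orlicz p (p / 2) a g <=
    Korl * (Ex a (fun x => N x `^ p)) `^ p^-1 + Corl * Ex a (fun x => `|g x|).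
Proof.
move=> gN; apply/ler_addgt0Pr => e e0.
have K0 := Korl_gt0; have C0 := Corl_gt0.
(* A slack that keeps both scales positive when A or B vanishes. *)
set d := e / (Korl + Corl); have d0 : 0 < d by rewrite divr_gt0 // addr_gt0.
set A := _ `^ p^-1; have A0 : 0 <= A by exact: powR_ge0.
set B := Ex a _; have B0 : 0 <= B by exact: Ex_ge0.
have -> : Korl * A + Corl * B + e = Korl * (A + d) + Corl * (B + d).
  by rewrite /d; field; rewrite gt_eqF // addr_gt0.
have Ad : 0 < A + d by rewrite ltr_wpDl.
have Bd : 0 < B + d by rewrite ltr_wpDl.
apply: orlicz_le; first by apply: addr_gt0; apply: mulr_gt0.
apply: Phi_concentration => //; last by rewrite lerDl ltW.
have E0 : 0 <= Ex a (fun x => N x `^ p) by apply: Ex_ge0 => // x; exact: powR_ge0.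
rewrite -[leLHS]powR_invK //; apply: le_powR => //; first exact: ltW.
by rewrite -/A lerDl ltW.
Qed.

End Orlicz.

(** * Rademacher averages control the gradient of the norm *)

Section RadAverages.
Variable R : realType.
Implicit Types (n : nat).

Lemma half01 : 0 <= (2^-1 : R) <= 1. Proof. by apply/andP; split; lra. Qed.

Lemma mu_half_flip n (x : cube n) i : mu 2^-1 (flip x i) = mu 2^-1 x :> R.
Proof. by rewrite -!sigma_mu. Qed.

Lemma Ex_flip n i (F : cube n -> R) : Ex 2^-1 (fun x => F (flip x i)) = Ex 2^-1 F.
Proof.
by rewrite /Ex -[RHS](sum_flip i); apply: eq_bigr => x _; rewrite mu_half_flip.
Qed.

Lemma Ex_odd n i (F : cube n -> R) : (forall x, F (flip x i) = - F x) -> Ex 2^-1 F = 0.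
Proof.
move=> Fi; have := Ex_flip i F.
rewrite (@eq_Ex _ _ _ _ (fun x => -1 * F x)) => [|x]; last by rewrite Fi mulN1r.
rewrite ExZ; lra.
Qed.

Section Riesz.
Variables (n : nat) (c : 'I_n -> R).

(* Real and imaginary parts of the Riesz product prod_(j <- s) (1 + i c_j x_j). *)
Definition riesz (s : seq 'I_n) (x : cube n) : R * R :=
  foldr (fun j z => (z.1 - c j * sgn R (x j) * z.2, z.2 + c j * sgn R (x j) * z.1)) (1, 0) s.

Lemma sgn_flip (x : cube n) i j : sgn R (flip x i j) = if j == i then - sgn R (x j) else sgn R (x j).
Proof.
by rewrite ffunE; case: eqP => [->|//]; rewrite /sgn; case: (x i); rewrite ?opprK.
Qed.

Lemma sgn_sqr b : sgn R b ^+ 2 = 1.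
Proof. by case: b; rewrite /sgn ?sqrrN expr1n. Qed.

Lemma riesz_flip s x i : i \notin s -> riesz s (flip x i) = riesz s x.
Proof.
elim: s => //= j s IH; rewrite inE negb_or => /andP[ij /IH ->].
by rewrite sgn_flip eq_sym (negPf ij).
Qed.

Lemma Ex_sgn_riesz s j : j \notin s ->
  Ex 2^-1 (fun x => sgn R (x j) * (riesz s x).1) = 0 /\
  Ex 2^-1 (fun x => sgn R (x j) * (riesz s x).2) = 0.
Proof.
by move=> js; split; apply: (@Ex_odd _ j) => x; rewrite sgn_flip eqxx riesz_flip // mulNr.
Qed.

Lemma Ex_riesz1 s : uniq s -> Ex 2^-1 (fun x => (riesz s x).1) = 1.
Proof.
elim: s => /= [_|j s IH /andP[js us]]; first by rewrite Ex_cst.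
rewrite (@eq_Ex _ _ _ _ (fun x => (riesz s x).1 + (- c j) * (sgn R (x j) * (riesz s x).2))).
  by rewrite ExD ExZ (Ex_sgn_riesz js).2 mulr0 addr0 IH.
by move=> x; rewrite mulNr mulrA.
Qed.

Lemma Ex_riesz2 s i : uniq s -> i \in s -> Ex 2^-1 (fun x => sgn R (x i) * (riesz s x).2) = c i.
Proof.
elim: s => //= j s IH /andP[js us]; rewrite inE.
rewrite (@eq_Ex _ _ _ _ (fun x => sgn R (x i) * (riesz s x).2 +
   c j * (sgn R (x i) * sgn R (x j) * (riesz s x).1))); last by move=> x; ring.
rewrite ExD ExZ; have [->|ij] := eqVneq i j => /=.
  rewrite (Ex_sgn_riesz js).2 add0r => _.
  rewrite (@eq_Ex _ _ _ _ (fun x => (riesz s x).1)) ?Ex_riesz1 ?mulr1 //.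
  by move=> x; rewrite -expr2 sgn_sqr mul1r.
move=> is_; rewrite IH // (@Ex_odd _ j) ?mulr0 ?addr0 // => x.
by rewrite !sgn_flip eqxx (negPf ij) riesz_flip // mulrN mulNr.
Qed.

Lemma riesz_sqr s x : (riesz s x).1 ^+ 2 + (riesz s x).2 ^+ 2 = \prod_(j <- s) (1 + c j ^+ 2).
Proof.
elim: s => /= [|j s IH]; first by rewrite big_nil; ring.
rewrite big_cons -IH; set z := riesz s x; have := sgn_sqr (x j); set b := sgn R _ => b2.
have -> : (z.1 - c j * b * z.2) ^+ 2 + (z.2 + c j * b * z.1) ^+ 2 =
  (1 + c j ^+ 2 * b ^+ 2) * (z.1 ^+ 2 + z.2 ^+ 2) by ring.
by rewrite b2 mulr1.
Qed.

(** The reason for complex factors: 1 + i c_j x_j has modulus sqrt(1 + c_j^2) for either sign, so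
    the l2-norm of c controls the product. Real factors 1 + c_j x_j would require the l1-norm. *)
Lemma riesz_bound x : \sum_i c i ^+ 2 <= 1 -> `|(riesz (enum 'I_n) x).2| <= 2.
Proof.
move=> c1; rewrite -(@ler_pXn2r _ 2) ?nnegrE // real_normK ?num_real //.
apply: (@le_trans _ _ (\prod_(j <- enum 'I_n) (1 + c j ^+ 2))).
  by rewrite -(riesz_sqr _ x) lerDr sqr_ge0.
apply: (@le_trans _ _ (expR 1)); last by have := expR1_le4 R; lra.
apply: (@le_trans _ _ (expR (\sum_i c i ^+ 2))); last by rewrite ler_expR.
rewrite expR_sum big_enum; apply: ler_prod => i _.
by rewrite expR_ge1Dx addr_ge0 ?sqr_ge0.
Qed.

End Riesz.

Variable X : normedModType R.

Definition Rad n (v : 'I_n -> X) : R :=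
  Ex 2^-1 (fun d : cube n => `|\sum_(i < n) sgn R (d i) *: v i|).

Lemma Rad_ge0 n (v : 'I_n -> X) : 0 <= Rad v.
Proof. by apply: Ex_ge0 => [|x]; [exact: half01|]. Qed.

Lemma norm_le_Rad n (c : 'I_n -> R) (v : 'I_n -> X) :
  \sum_i c i ^+ 2 <= 1 -> `|\sum_i c i *: v i| <= 2 * Rad v.
Proof.
move=> c1; pose Q x := (riesz c (enum 'I_n) x).2.
have -> : \sum_i c i *: v i =
    \sum_(x : cube n) (mu 2^-1 x * Q x) *: \sum_i sgn R (x i) *: v i.
  under [RHS]eq_bigr do rewrite scaler_sumr.
  rewrite exchange_big /=; apply: eq_bigr => i _.
  rewrite -(@Ex_riesz2 n c (enum 'I_n) i) ?enum_uniq ?mem_enum // /Ex scaler_suml.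
  by apply: eq_bigr => x _; rewrite scalerA mulrCA mulrC.
apply: le_trans (ler_norm_sum _ _ _) _; rewrite /Rad -ExZ; apply: ler_sum => x _.
have m0 : 0 <= mu 2^-1 x :> R by rewrite mu_ge0 // half01.
rewrite normrZ normrM (ger0_norm m0) -mulrA; apply: ler_wpM2l => //.
by apply: ler_wpM2r => //; exact: riesz_bound.
Qed.

(* Convexity at u replaces a norming functional of u. *)
Lemma norm_drop_convex n (u : X) (d : 'I_n -> X) :
  \sum_i pos (`|u| - `|u - d i|) ^+ 2 <= `|\sum_i pos (`|u| - `|u - d i|) *: d i|.
Proof.
pose b i := pos (`|u| - `|u - d i|).
change (\sum_i b i ^+ 2 <= `|\sum_i b i *: d i|).
have b0 i : 0 <= b i by exact: pos_ge0.
have S0 : 0 <= \sum_i b i by exact: sumr_ge0.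
(* So small that u - t sum_i b_i d_i is a convex combination of u and the points u - d_i. *)
set t := (1 + \sum_i b i)^-1.
have t0 : 0 < t by rewrite invr_gt0 ltr_wpDr.
have tS : t * \sum_i b i <= 1 by rewrite mulrC ler_pdivrMr ?mul1r ?lerDr ?ltr_wpDr.
rewrite -(ler_pM2l t0).
have h1 : t * \sum_i b i ^+ 2 = \sum_i (t * b i) * (`|u| - `|u - d i|).
  rewrite mulr_sumr; apply: eq_bigr => i _; rewrite expr2 mulrA.
  rewrite /b; have [h|h] := lerP (`|u| - `|u - d i|) 0; first by rewrite le0_pos // !mulr0 mul0r.
  by rewrite ge0_pos // ltW.
have h2 : u - t *: \sum_i b i *: d i =
    (1 - t * \sum_i b i) *: u + \sum_i (t * b i) *: (u - d i).
  under [X in _ = _ + X]eq_bigr do rewrite scalerBr.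
  rewrite sumrB -scaler_suml -mulr_sumr addrA -scalerDl subrK scale1r; congr (_ - _).
  by rewrite scaler_sumr; apply: eq_bigr => i _; rewrite scalerA.
have h3 : `|u - t *: \sum_i b i *: d i| <=
    (1 - t * \sum_i b i) * `|u| + \sum_i (t * b i) * `|u - d i|.
  rewrite h2; apply: le_trans (ler_normD _ _) _.
  rewrite normrZ ger0_norm ?subr_ge0 // lerD2l.
  apply: le_trans (ler_norm_sum _ _ _) _; apply: ler_sum => i _.
  by rewrite normrZ ger0_norm // mulr_ge0 // ltW.
have h4 : `|u| <= `|u - t *: \sum_i b i *: d i| + t * `|\sum_i b i *: d i|.
  have := ler_normD (u - t *: \sum_i b i *: d i) (t *: \sum_i b i *: d i).
  by rewrite subrK normrZ gtr0_norm.
have h5 : \sum_i (t * b i) * (`|u| - `|u - d i|) =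
    t * (\sum_i b i) * `|u| - \sum_i (t * b i) * `|u - d i|.
  rewrite mulr_sumr mulr_suml -sumrB; apply: eq_bigr => i _; ring.
rewrite h1 h5; move: h3 h4; set S := \sum_i b i; lra.
Qed.

Section GradientBound.
Variables (a k : R).
Hypotheses (a01 : 0 < a < 1) (ak : a^-1 <= k) (bk : (1 - a)^-1 <= k).

Lemma sub_flip n (f : cube n -> X) x i :
  f x - f (flip x i) = (if x i then (1 - a)^-1 else a^-1) *: dpart a f i x.
Proof.
have /andP[a0 a1] := a01; have n1 : a != 0 by rewrite gt_eqF.
have n2 : 1 - a != 0 by rewrite subr_eq0 eq_sym lt_eqF.
rewrite /dpart; case: (x i) (setc_flip_cases x i) => -[-> ->].
  have -> : f x - a *: f x = (1 - a) *: f x by rewrite scalerBl scale1r.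
  by rewrite -scalerBr scalerA mulVf // scale1r.
rewrite addrAC; have -> : f x - (1 - a) *: f x = a *: f x.
  by rewrite -{1}[f x]scale1r -scalerBl; congr (_ *: _); ring.
by rewrite -scalerBr scalerA mulVf // scale1r.
Qed.

(** The increments divided by their own l2-norm A serve as coefficients in [norm_le_Rad]. With
    [norm_drop_convex] this gives A^2 <= 2 k A Rad, and A cancels; k absorbs the ratio between flip
    differences and [dpart]. *)
Lemma grad_norm_le_Rad n (f : cube n -> X) x :
  grad (fun x => `|f x|) x <= 2 * k * Rad (fun i => dpart a f i x).
Proof.
have /andP[a0 a1] := a01.
have k0 : 0 < k by apply: lt_le_trans ak; rewrite invr_gt0.
set A := grad _ x; have A0 : 0 <= A by exact: grad_ge0.
have R0 := Rad_ge0 (fun i => dpart a f i x).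
move: A0; rewrite le_eqVlt => /predU1P[<-|A0]; first by rewrite mulr_ge0 // mulr_ge0 // ltW.
pose d i := f x - f (flip x i).
pose b i := pos (`|f x| - `|f x - d i|).
pose l i := if x i then (1 - a)^-1 else a^-1.
have A2 : A ^+ 2 = \sum_i b i ^+ 2.
  rewrite sqr_sqrtr ?gradsq_ge0 // /gradsq big_enum.
  by apply: eq_bigr => i _; rewrite /b /d subKr.
have l0 i : 0 <= l i by rewrite /l; case: ifP => _; rewrite invr_ge0; lra.
have lk i : l i <= k by rewrite /l; case: ifP.
have kA : 0 < k * A by rewrite mulr_gt0.
have c1 : \sum_i (b i * l i / (k * A)) ^+ 2 <= 1.
  apply: (@le_trans _ _ (\sum_i b i ^+ 2 / A ^+ 2)).
    apply: ler_sum => i _.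
    have -> : (b i * l i / (k * A)) ^+ 2 = b i ^+ 2 / A ^+ 2 * (l i / k) ^+ 2.
      by field; rewrite !gt_eqF.
    rewrite ler_piMr ?divr_ge0 ?sqr_ge0 // expr_le1 ?divr_ge0 ?(ltW k0) //.
    by rewrite ler_pdivrMr // mul1r.
  by rewrite -mulr_suml -A2 divff // expf_neq0 // gt_eqF.
have := norm_le_Rad (fun i => dpart a f i x) c1.
have -> : \sum_i (b i * l i / (k * A)) *: dpart a f i x = (k * A)^-1 *: \sum_i b i *: d i.
  rewrite scaler_sumr; apply: eq_bigr => i _.
  by rewrite /d sub_flip !scalerA mulrC mulrA.
rewrite normrZ gtr0_norm ?invr_gt0 // mulrC ler_pdivrMr //.
have h1 : \sum_i b i ^+ 2 <= `|\sum_i b i *: d i| := norm_drop_convex (f x) d.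
move=> h2; rewrite -A2 in h1.
have := le_trans h1 h2.
have -> : 2 * Rad (fun i => dpart a f i x) * (k * A) =
  A * (2 * k * Rad (fun i => dpart a f i x)) by ring.
by rewrite expr2 ler_pM2l.
Qed.

End GradientBound.
End RadAverages.

(** * Interpolation between independent points *)

Section ProductExpansion.
Variable R : realType.

(** C is uniform in s and t, so that N steps of length L / N in [dist_mvt] have total error of order
    1 / N. *)
Lemma prod_expansion (I : Type) (r : seq I) (S : R) : 0 <= S ->
  exists2 C, 0 <= C & forall (s : I -> R) (t : R), (forall j, `|s j| <= S) -> 0 <= t <= 1 ->
    `|\prod_(j <- r) (1 + t * s j) - 1 - t * \sum_(j <- r) s j| <= C * t ^+ 2.
Proof.
move=> S0; elim: r => [|i r [C C0 IH]].
  by exists 0 => // s t _ _; rewrite !big_nil mulr0 subr0 subrr normr0 mul0r.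
exists (C * (1 + S) + S * ((size r)%:R * S)).
  by rewrite addr_ge0 ?mulr_ge0 ?addr_ge0.
move=> s t sS t01; have /andP[t0 t1] := t01; rewrite !big_cons.
have := IH s t sS t01; set P := \prod_(j <- r) _; set Q := \sum_(j <- r) _ => PQ.
have Qb : `|Q| <= (size r)%:R * S.
  apply: le_trans (ler_norm_sum _ _ _) _; apply: le_trans (ler_sum _ (fun j _ => sS j)) _.
  by rewrite big_const_seq count_predT iter_addr_0 mulr_natl.
have -> : (1 + t * s i) * P - 1 - t * (s i + Q) =
    (P - 1 - t * Q) * (1 + t * s i) + s i * Q * t ^+ 2 by ring.
apply: le_trans (ler_normD _ _) _; rewrite [leRHS]mulrDl; apply: lerD.
  rewrite normrM mulrAC; apply: ler_pM => //.
  apply: le_trans (ler_normD _ _) _; rewrite normr1 lerD2l normrM (ger0_norm t0).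
  by rewrite -[leRHS]mul1r; apply: ler_pM.
rewrite normrM normrX (ger0_norm t0); apply: ler_wpM2r; first exact: sqr_ge0.
by rewrite normrM; apply: ler_pM.
Qed.

End ProductExpansion.

Section Interpolation.
Variables (R : realType) (X : normedModType R).
Variable a : R.
Hypothesis a01 : 0 < a < 1.
Variable n : nat.
Implicit Types (b x y z : cube n) (r t : R) (f : cube n -> X).

Let a01' : 0 <= a <= 1. Proof. by have /andP[? ?] := a01; rewrite !ltW. Qed.

Definition mix b x y : cube n := [ffun i => if b i then x i else y i].

Lemma mixK b x y : mix b (mix b x y) (mix b y x) = x.
Proof. by apply/ffunP => i; rewrite !ffunE; case: (b i). Qed.

Lemma mu_mix q b x y : mu q (mix b x y) * mu q (mix b y x) = mu q x * mu q y :> R.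
Proof.
rewrite /mu -!big_split /=; apply: eq_bigr => i _; rewrite !ffunE.
by case: (b i) => //; rewrite mulrC.
Qed.

(** (x, y) -> (mix b x y, mix b y x) is an involution preserving the product of the two measures. *)
Lemma Ex_swap q b (F : cube n -> cube n -> R) :
  Ex q (fun x => Ex q (fun y => F (mix b x y) (mix b y x))) =
  Ex q (fun x => Ex q (F x)).
Proof.
have E (G : cube n -> cube n -> R) : Ex q (fun x => Ex q (G x)) =
    \sum_(z : cube n * cube n) mu q z.1 * mu q z.2 * G z.1 z.2.
  rewrite -(pair_bigA _ (fun x y => mu q x * mu q y * G x y)) /=.
  by apply: eq_bigr => x _; rewrite mulr_sumr; apply: eq_bigr => y _; rewrite mulrA.
rewrite !E; pose h (z : cube n * cube n) := (mix b z.1 z.2, mix b z.2 z.1).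
have hK : involutive h by case=> x y; rewrite /h /= !mixK.
rewrite [RHS](reindex_inj (inv_inj hK)); apply: eq_bigr => z _.
by rewrite /h /= mu_mix.
Qed.

Lemma Ex_mix q b (F : cube n -> R) :
  Ex q (fun x => Ex q (fun y => F (mix b x y))) = Ex q F.
Proof.
rewrite (Ex_swap q b (fun x _ => F x)); apply: eq_Ex => x; exact: Ex_cst.
Qed.

Definition interp r f x y : X := \sum_(b : cube n) mu r b *: f (mix b x y).

(* Logarithmic derivative in r of the weight of a Bernoulli(r) bit. *)
Definition rate r (c : bool) : R := if c then r^-1 else - (1 - r)^-1.

Definition dist f r t : R :=
  Ex a (fun x => Ex a (fun y => `|interp t f x y - interp r f x y|)).

Lemma dist_triangle f r s t : dist f r t <= dist f r s + dist f s t.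
Proof.
rewrite /dist -ExD; apply: (le_Ex a01') => x; rewrite -ExD; apply: (le_Ex a01') => y.
by rewrite [leRHS]addrC; exact: ler_distD.
Qed.

Lemma mu_shift r t b : 0 < r < 1 ->
  mu (r + t) b = mu r b * \prod_i (1 + t * rate r (b i)).
Proof.
move=> /andP[r0 r1]; rewrite /mu -big_split /=; apply: eq_bigr => i _.
rewrite /rate; case: (b i); first by rewrite mulrDr mulr1 mulrCA divff ?mulr1 // gt_eqF.
by field; rewrite subr_eq0 eq_sym lt_eqF.
Qed.

(** Given the other bits, the rate of bit i has mean r / r - (1 - r) / (1 - r) = 0; pairing b with
    its flip shows that the sum is its own opposite. *)
Lemma sum_rate r i (G : cube n -> X) : 0 < r < 1 ->
  (forall b, G (flip b i) = G b) -> \sum_b (mu r b * rate r (b i)) *: G b = 0.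
Proof.
move=> /andP[r0 r1] Gi.
have n1 : r != 0 by rewrite gt_eqF.
have n2 : 1 - r != 0 by rewrite subr_eq0 eq_sym lt_eqF.
set S := \sum_b _.
have SN : S = - S.
  rewrite {1}/S -(sum_flip i) -sumrN; apply: eq_bigr => b _.
  rewrite Gi -scaleNr; congr (_ *: _).
  rewrite mu_flip (muE r b i) flip_at /rate; case: (b i) => /=.
    by rewrite mulrAC mulrN divff // mulrAC divff // mulN1r mul1r.
  by rewrite mulrAC divff // mulrAC mulrN divff // mulN1r mul1r opprK.
have : S + S = 0 by rewrite {2}SN subrr.
move=> S2; have : (2^-1 + 2^-1) *: S = 0 by rewrite scalerDl -scalerDr S2 scaler0.
by rewrite (_ : 2^-1 + 2^-1 = 1) ?scale1r //; lra.
Qed.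

Lemma setc_mix_flip b x y i c : setc (mix (flip b i) x y) i c = setc (mix b x y) i c.
Proof. by apply/ffunP => j; rewrite !ffunE; case: (eqVneq j i). Qed.

(** f minus [dpart a f i] is an average over coordinate i, hence blind to bit b_i, and [sum_rate]
    annihilates it. *)
Lemma sum_rate_dpart r f x y : 0 < r < 1 ->
  \sum_b mu r b *: ((\sum_i rate r (b i)) *: f (mix b x y)) =
  \sum_b mu r b *: (\sum_i rate r (b i) *: dpart a f i (mix b x y)).
Proof.
move=> r01; apply/eqP; rewrite -subr_eq0 -sumrB.
under eq_bigr => b _ do rewrite -scalerBr scaler_suml -sumrB scaler_sumr.
rewrite exchange_big big1 //= => i _.
under eq_bigr => b _ do rewrite -scalerBr scalerA.
apply: (@sum_rate r i (fun b => f (mix b x y) - dpart a f i (mix b x y)) r01) => b.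
have E c : f (mix c x y) - dpart a f i (mix c x y) =
    a *: f (setc (mix c x y) i true) + (1 - a) *: f (setc (mix c x y) i false).
  by rewrite /dpart -addrA -opprD subKr.
by rewrite !E !setc_mix_flip.
Qed.

Definition Wnorm r (v : 'I_n -> X) : R :=
  Ex r (fun b => `|\sum_i ((b i)%:R - r) *: v i|).

Lemma rateE r c : 0 < r < 1 -> rate r c = (r * (1 - r))^-1 * (c%:R - r).
Proof.
move=> /andP[r0 r1]; have n1 : r != 0 by rewrite gt_eqF.
have n2 : 1 - r != 0 by rewrite subr_eq0 eq_sym lt_eqF.
by rewrite /rate; case: c => /=; field; rewrite n1 n2.
Qed.

Lemma norm_rate r (lo hi : R) c : 0 < lo -> hi < 1 -> lo <= r <= hi ->
  `|rate r c| <= lo^-1 + (1 - hi)^-1.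
Proof.
move=> lo0 hi1 /andP[lor rhi].
have i1 : 0 <= lo^-1 by rewrite invr_ge0 ltW.
have i2 : 0 <= (1 - hi)^-1 by rewrite invr_ge0; lra.
rewrite /rate; case: c; rewrite ?normrN ger0_norm ?invr_ge0; try lra.
  by apply: (@le_trans _ _ lo^-1); [rewrite lef_pV2 ?posrE //; lra|lra].
by apply: (@le_trans _ _ (1 - hi)^-1); [rewrite lef_pV2 ?posrE //; lra|lra].
Qed.

(** For each fixed b the point [mix b x y] has law mu_a. Averaging over x and y therefore decouples
    the bits from the point, and the derivatives are taken at a z independent of b. *)
Lemma dist_step f (lo hi : R) : 0 < lo -> hi < 1 -> exists2 C, 0 <= C &
  forall r t, lo <= r <= hi -> 0 <= t <= 1 ->
  dist f r (r + t) <=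
    t * ((r * (1 - r))^-1 * Ex a (fun z => Wnorm r (fun i => dpart a f i z))) + C * t ^+ 2.
Proof.
move=> lo0 hi1; have S0 : 0 <= lo^-1 + (1 - hi)^-1.
  by apply: addr_ge0; rewrite invr_ge0; lra.
have [C C0 HC] := prod_expansion (index_enum 'I_n) S0.
exists (C * Ex a (fun z => `|f z|)); first by rewrite mulr_ge0 // Ex_ge0.
move=> r t rlh t01; have /andP[t0 t1] := t01; have /andP[lor rhi] := rlh.
have r01 : 0 < r < 1 by apply/andP; split; lra.
have r01' : 0 <= r <= 1 by apply/andP; split; lra.
have q0 : 0 <= (r * (1 - r))^-1 by rewrite invr_ge0 mulr_ge0 //; lra.
have m0 b : 0 <= mu r b by exact: mu_ge0.
pose rem b := \prod_i (1 + t * rate r (b i)) - 1 - t * \sum_i rate r (b i).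
have remC b : `|rem b| <= C * t ^+ 2.
  by apply: (HC (fun i => rate r (b i))) => // i; exact: norm_rate.
have key x y : interp (r + t) f x y - interp r f x y =
    t *: (\sum_b mu r b *: (\sum_i rate r (b i) *: dpart a f i (mix b x y))) +
    \sum_b (mu r b * rem b) *: f (mix b x y).
  rewrite -sum_rate_dpart // /interp -sumrB scaler_sumr -big_split /=.
  apply: eq_bigr => b _; rewrite mu_shift // !scalerA -scalerBl -scalerDl.
  by congr (_ *: _); rewrite /rem; ring.
have bound x y : `|interp (r + t) f x y - interp r f x y| <=
    t * ((r * (1 - r))^-1 *
      Ex r (fun b => `|\sum_i ((b i)%:R - r) *: dpart a f i (mix b x y)|)) +
    C * t ^+ 2 * Ex r (fun b => `|f (mix b x y)|).
  rewrite key; apply: le_trans (ler_normD _ _) _; apply: lerD.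
    rewrite normrZ (ger0_norm t0); apply: ler_wpM2l => //.
    apply: le_trans (ler_norm_sum _ _ _) _; rewrite -ExZ; apply: ler_sum => b _.
    rewrite normrZ (ger0_norm (m0 b)); apply: ler_wpM2l => //.
    under eq_bigr do rewrite rateE // -scalerA.
    by rewrite -scaler_sumr normrZ ger0_norm.
  apply: le_trans (ler_norm_sum _ _ _) _; rewrite -ExZ; apply: ler_sum => b _.
  rewrite normrZ normrM (ger0_norm (m0 b)) -mulrA; apply: ler_wpM2l => //.
  exact: ler_wpM2r.
apply: le_trans (le_Ex a01' (fun x => le_Ex a01' (bound x))) _.
have sw (F : cube n -> cube n -> R) :
    Ex a (fun x => Ex a (fun y => Ex r (fun b => F b (mix b x y)))) = Ex r (fun b => Ex a (F b)).
  under eq_Ex => x do rewrite exchange_Ex.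
  by rewrite exchange_Ex; apply: eq_Ex => b; rewrite (Ex_mix a b (F b)).
under eq_Ex => x do rewrite ExD !ExZ.
rewrite ExD !ExZ (sw (fun b z => `|\sum_i ((b i)%:R - r) *: dpart a f i z|)).
by rewrite (sw (fun b z => `|f z|)) Ex_cst exchange_Ex [C * _ * Ex a _]mulrAC lexx.
Qed.

Lemma dist_mvt f (lo hi B : R) : 0 < lo -> lo <= hi -> hi < 1 -> 
  (forall r, lo <= r <= hi ->
    (r * (1 - r))^-1 * Ex a (fun z => Wnorm r (fun i => dpart a f i z)) <= B) ->
  dist f lo hi <= (hi - lo) * B.
Proof.
move=> lo0 lohi hi1 HB; have [C C0 HC] := dist_step f lo0 hi1.
set L := hi - lo; have L0 : 0 <= L by rewrite subr_ge0.
have L1 : L <= 1 by rewrite /L; lra.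
apply/ler_addgt0Pr => e e0.
pose N := (Num.truncn (C * L ^+ 2 / e)).+1.
have NN : C * L ^+ 2 / e < N%:R.
  by have /andP[] : N.-1%:R <= C * L ^+ 2 / e < N%:R
    by rewrite truncn_itv // divr_ge0 ?mulr_ge0 ?sqr_ge0 // ltW.
have N0 : 0 < N%:R :> R by rewrite ltr0n.
pose t := L / N%:R.
have t0 : 0 <= t by rewrite divr_ge0.
have tN : N%:R * t = L by rewrite mulrC divfK // gt_eqF.
have t1 : t <= 1.
  by rewrite ler_pdivrMr // mul1r (le_trans L1) // ler1n.
have steps j : (j <= N)%N -> dist f lo (lo + j%:R * t) <= j%:R * (t * B + C * t ^+ 2).
  elim: j => [|j IH] jN.
    rewrite !mul0r addr0 /dist -[leRHS](Ex_cst a n 0); apply: (le_Ex a01') => x.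
    by rewrite -[leRHS](Ex_cst a n 0); apply: (le_Ex a01') => y; rewrite subrr normr0.
  apply: le_trans (dist_triangle f lo (lo + j%:R * t) _) _.
  have -> : lo + j.+1%:R * t = lo + j%:R * t + t by rewrite -natr1; ring.
  have jr : lo <= lo + j%:R * t <= hi.
    rewrite lerDl mulr_ge0 //=; have : j%:R * t <= N%:R * t.
      by rewrite ler_wpM2r // ler_nat ltnW.
    by rewrite tN /L; lra.
  have -> : j.+1%:R * (t * B + C * t ^+ 2) = j%:R * (t * B + C * t ^+ 2) + (t * B + C * t ^+ 2).
    by rewrite -natr1; ring.
  apply: lerD; first by apply: IH; exact: ltnW.
  apply: le_trans (HC _ t jr _) _; first by rewrite t0.
  by rewrite lerD2r; apply: ler_wpM2l => //; exact: HB.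
have := steps N (leqnn N); rewrite tN.
have -> : lo + L = hi by rewrite /L; ring.
move=> /le_trans; apply.
have -> : N%:R * (t * B + C * t ^+ 2) = L * B + C * L ^+ 2 / N%:R.
  by rewrite /t; field; rewrite gt_eqF.
by rewrite lerD2l ler_pdivrMr // [e * _]mulrC -ler_pdivrMr // ltW.
Qed.

Lemma interp_half_sym f x y : interp 2^-1 f x y = interp 2^-1 f y x.
Proof.
pose h b : cube n := [ffun i => ~~ b i].
have hK : involutive h by move=> b; apply/ffunP => i; rewrite !ffunE negbK.
rewrite /interp [RHS](reindex_inj (inv_inj hK)); apply: eq_bigr => b _.
rewrite -!sigma_mu; congr (_ *: f _); apply/ffunP => i; rewrite !ffunE.
by case: (b i).
Qed.

(** Only b distinct from 0 contributes, with total mass 1 - (1 - r)^n <= n r; both f (mix b x y) and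
    f y are compared with c. *)
Lemma interp_near f (c : X) r : 0 <= r <= 1 ->
  Ex a (fun x => Ex a (fun y => `|interp r f x y - f y|)) <=
  2 * (n%:R * r) * Ex a (fun x => `|f x - c|).
Proof.
move=> r01; have /andP[r0 r1] := r01.
pose b0 : cube n := [ffun=> false].
have m0 : mu r b0 = (1 - r) ^+ n.
  rewrite /mu (eq_bigr (fun=> 1 - r)) => [|i _]; last by rewrite ffunE.
  by rewrite prodr_const card_ord.
have bern : 1 - n%:R * r <= (1 - r) ^+ n.
  elim: (n) => [|m IH]; first by rewrite mul0r subr0 expr0.
  rewrite exprS -natr1; have := ler_wpM2l (_ : 0 <= 1 - r) IH.
  have : 0 <= m%:R * r ^+ 2 by rewrite mulr_ge0 ?sqr_ge0.
  by move=> h1 /(_ _) h2; have := h2 ltac:(lra); lra.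
pose G x := `|f x - c|.
have bd x y : `|interp r f x y - f y| <=
    \sum_(b | b != b0) mu r b * (G (mix b x y) + G y).
  have -> : interp r f x y - f y = \sum_(b | b != b0) mu r b *: (f (mix b x y) - f y).
    rewrite -[f y in LHS]scale1r -(sum_mu r n) scaler_suml /interp -sumrB (bigD1 b0) //=.
    have -> : mix b0 x y = y by apply/ffunP => i; rewrite !ffunE.
    by rewrite subrr add0r; apply: eq_bigr => b _; rewrite scalerBr.
  apply: le_trans (ler_norm_sum _ _ _) _; apply: ler_sum => b _.
  rewrite normrZ ger0_norm ?mu_ge0 //; apply: ler_wpM2l; first exact: mu_ge0.
  have -> : f (mix b x y) - f y = (f (mix b x y) - c) - (f y - c) by rewrite opprB addrA subrK.
  exact: ler_normB.
apply: le_trans (le_Ex a01' (fun x => le_Ex a01' (bd x))) _.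
under eq_Ex => x do rewrite Ex_sum.
rewrite Ex_sum.
under eq_bigr => b _.
  under eq_Ex => x do rewrite ExZ ExD.
  rewrite ExZ ExD Ex_mix Ex_cst; over.
rewrite -mulr_suml.
have -> : \sum_(b | b != b0) mu r b = 1 - (1 - r) ^+ n.
  by have := sum_mu r n; rewrite (bigD1 b0) //= m0 => h; rewrite -[X in _ = X - _]h addrC addrK.
have G0 : 0 <= Ex a G by apply: Ex_ge0 => // x; exact: normr_ge0.
have := ler_wpM2r G0 (_ : 1 - (1 - r) ^+ n <= n%:R * r).
by move=> /(_ _) h; have := h ltac:(lra); rewrite -/G; lra.
Qed.

(** At r = 1/2 the interpolation is symmetric in x and y, so |f x - f y| is at most twice the
    distance to it on average. With n r <= 1/8 the error from [interp_near] is half of the left side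
    and is absorbed. *)
Lemma norm_center_le f r : 0 <= r -> n%:R * r <= 1 / 8 -> r <= 1 ->
  Ex a (fun x => `|f x - mean a f|) <= 4 * dist f r 2^-1.
Proof.
move=> r0 nr r1; set c := mean a f.
have G0 : 0 <= Ex a (fun x => `|f x - c|) by apply: Ex_ge0.
have h1 : Ex a (fun x => `|f x - c|) <= Ex a (fun x => Ex a (fun y => `|f x - f y|)).
  apply: (le_Ex a01') => x.
  have -> : f x - c = \sum_y mu a y *: (f x - f y).
    under [RHS]eq_bigr do rewrite scalerBr.
    by rewrite sumrB -scaler_suml sum_mu scale1r.
  apply: le_trans (ler_norm_sum _ _ _) _; apply: ler_sum => y _.
  by rewrite normrZ ger0_norm // mu_ge0.
pose H x y := `|interp 2^-1 f x y - f y|.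
have h2 : Ex a (fun x => Ex a (fun y => `|f x - f y|)) <=
    2 * Ex a (fun x => Ex a (fun y => H x y)).
  have -> : 2 * Ex a (fun x => Ex a (fun y => H x y)) =
      Ex a (fun x => Ex a (fun y => H x y + H y x)).
    under [RHS]eq_Ex => x do rewrite ExD.
    rewrite ExD [X in _ = _ + X](exchange_Ex a a (fun x y => H y x)); ring.
  apply: (le_Ex a01') => x; apply: (le_Ex a01') => y.
  rewrite /H -(interp_half_sym f x y).
  have -> : f x - f y = (interp 2^-1 f x y - f y) - (interp 2^-1 f x y - f x).
    by rewrite opprB [RHS]addrC addrA subrK.
  exact: ler_normB.
have h3 : Ex a (fun x => Ex a (fun y => H x y)) <=
    dist f r 2^-1 + Ex a (fun x => Ex a (fun y => `|interp r f x y - f y|)).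
  rewrite /dist -ExD; apply: (le_Ex a01') => x; rewrite -ExD; apply: (le_Ex a01') => y.
  by rewrite /H; exact: ler_distD.
have r01 : 0 <= r <= 1 by rewrite r0.
have h4 := interp_near f c r01.
have h5 := ler_wpM2r G0 nr.
lra.
Qed.

(** On [2^-(k+2), 2^-(k+1)] the factor 1 / (r (1 - r)) is at most 2 / 2^-(k+2), and the length
    cancels the denominator: the cost is 2 beta_k. [norm_center_le] contributes the remaining factor
    4. *)
Lemma poincare_dyadic f K (beta : nat -> R) : (8 * n <= 2 ^ K.+1)%N ->
  (forall k r (v : 'I_n -> X), (2^-1 : R) ^+ k.+2 <= r <= 2^-1 ^+ k.+1 ->
     Wnorm r v <= beta k * Rad v) ->
  Ex a (fun x => `|f x - mean a f|) <=
    8 * (\sum_(k < K) beta k) * Ex a (fun z => Rad (fun i => dpart a f i z)).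
Proof.
move=> nK Hb; pose h k : R := 2^-1 ^+ k.
have h0 k : 0 < h k by rewrite exprn_gt0 // invr_gt0.
have h1 k : h k <= 1 by rewrite exprn_ile1 //; lra.
have hS k : h k.+1 = h k / 2 by rewrite /h exprSr.
set V := Ex a (fun z => Rad (fun i => dpart a f i z)).
have V0 : 0 <= V by apply: Ex_ge0 => // z; exact: Rad_ge0.
have step k : dist f (h k.+2) (h k.+1) <= 2 * (beta k * V).
  have hk := h0 k; have hk1 := h1 k.
  have e1 := hS k; have e2 := hS k.+1.
  apply: le_trans (@dist_mvt f (h k.+2) (h k.+1) (2 * (h k.+2)^-1 * (beta k * V)) _ _ _ _) _ => //.
  - by lra.
  - by lra.
  - move=> r rh; have /andP[rh1 rh2] := rh.
    have W0 : 0 <= Ex a (fun z => Wnorm r (fun i => dpart a f i z)).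
      apply: Ex_ge0 => // z; apply: Ex_ge0 => //; apply/andP; split; lra.
    have p2 : 0 < h k.+2 / 2 by rewrite divr_gt0.
    have p3 : 0 < r * (1 - r) by apply: mulr_gt0; lra.
    have p4 : h k.+2 / 2 <= r * (1 - r) by apply: ler_pM; lra.
    apply: ler_pM => //; first by rewrite invr_ge0 ltW.
      have -> : 2 * (h k.+2)^-1 = (h k.+2 / 2)^-1 by rewrite invf_div.
      by rewrite lef_pV2 ?posrE.
    rewrite /V -ExZ; apply: (le_Ex a01') => z; exact: Hb.
  - have -> : h k.+1 - h k.+2 = h k.+2 by lra.
    by rewrite -[2 / _ * _]mulrA mulrCA mulVKf // gt_eqF.
have tot j : dist f (h j.+1) 2^-1 <= 2 * ((\sum_(k < j) beta k) * V).
  elim: j => [|j IH].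
    rewrite big_ord0 mul0r mulr0 /h expr1 /dist -[leRHS](Ex_cst a n 0).
    apply: (le_Ex a01') => x; rewrite -[leRHS](Ex_cst a n 0); apply: (le_Ex a01') => y.
    by rewrite subrr normr0.
  apply: le_trans (dist_triangle f _ (h j.+1) _) _.
  by rewrite big_ord_recr /= [X in 2 * X]mulrDl [leRHS]mulrDr [leRHS]addrC; apply: lerD.
have nh : n%:R * h K.+1 <= 1 / 8.
  rewrite /h exprVn ler_pdivrMr ?exprn_gt0 //.
  rewrite -natrX; have : (8 * n)%:R <= (2 ^ K.+1)%:R :> R by rewrite ler_nat.
  by rewrite natrM; lra.
apply: le_trans (norm_center_le f (ltW (h0 K.+1)) nh (h1 K.+1)) _.
by have := tot K; rewrite -/V; lra.
Qed.

End Interpolation.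

(** * Bernoulli averages and cotype *)

Section Jensen.
Variable R : realType.

Lemma jensen_powR (q : R) (I : finType) (w z : I -> R) : 1 <= q ->
  (forall i, 0 <= w i) -> \sum_i w i = 1 -> (forall i, 0 <= z i) ->
  (\sum_i w i * z i) `^ q <= \sum_i w i * z i `^ q.
Proof.
move=> q1 w0 w1 z0; set m := \sum_i w i * z i.
have m0 : 0 <= m by apply: sumr_ge0 => i _; exact: mulr_ge0.
move: m0; rewrite le_eqVlt => /predU1P[m0|m0].
  rewrite -m0 powR0; last by rewrite gt_eqF //; lra.
  by apply: sumr_ge0 => i _; rewrite mulr_ge0 ?powR_ge0.
(* Bernoulli's inequality at z / m is the tangent of the q-th power at the mean m. *)
have tangent i : m `^ q * (1 - q * (1 - z i / m)) <= z i `^ q.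
  have zm : 0 <= z i / m by rewrite divr_ge0 // ltW.
  have -> : z i `^ q = m `^ q * (z i / m) `^ q.
    by rewrite -powRM ?(ltW m0) // mulrC divfK // gt_eqF.
  by apply: ler_wpM2l; [exact: powR_ge0|exact: bernoulli_powR].
apply: le_trans (ler_sum _ (fun i _ => ler_wpM2l (w0 i) (tangent i))).
have -> : \sum_i w i * (m `^ q * (1 - q * (1 - z i / m))) =
    m `^ q * ((1 - q) * \sum_i w i + q / m * \sum_i w i * z i).
  by rewrite !mulr_sumr -big_split mulr_sumr /=; apply: eq_bigr => i _; ring.
rewrite w1 -/m divfK ?gt_eqF //.
have -> : (1 - q) * 1 + q = 1 by ring.
by rewrite mulr1.
Qed.

Lemma jensen_Ex (q a : R) n (F : cube n -> R) : 1 <= q -> 0 <= a <= 1 ->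
  (forall x, 0 <= F x) -> (Ex a F) `^ q <= Ex a (fun x => F x `^ q).
Proof.
move=> q1 a01 F0; apply: jensen_powR => // [x|]; [exact: mu_ge0|exact: sum_mu].
Qed.

Lemma powR_midpoint (q x y : R) : 1 <= q -> 0 <= x -> 0 <= y ->
  ((x + y) / 2) `^ q <= (x `^ q + y `^ q) / 2.
Proof.
move=> q1 x0 y0.
have := @jensen_powR q bool (fun=> 2^-1) (fun b => if b then x else y) q1.
rewrite !big_bool /= -!mulrDr [2^-1 * _]mulrC [2^-1 * (_ `^ _ + _)]mulrC; apply => //.
- by lra.
- by case.
Qed.

Lemma powR_inv_mono (q x y : R) : 0 < q -> 0 <= x -> 0 <= y -> x `^ q <= y `^ q -> x <= y.
Proof.
move=> q0 x0 y0 xy; have qi : 0 <= q^-1 by rewrite invr_ge0 ltW.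
have := le_powR qi (powR_ge0 x q) xy.
by rewrite -!powRrM mulfV ?gt_eqF // !powRr1.
Qed.

End Jensen.

(** * Symmetrization, contraction and comparison of moments *)

Section Contraction.
Variables (R : realType) (X : normedModType R).
Variable n : nat.
Implicit Types (v : 'I_n -> X) (s t x : cube n).

Let h01 := half01 R.

Lemma Ex_sign s (F : ('I_n -> R) -> R) :
  Ex 2^-1 (fun x : cube n => F (fun i => sgn R (s i) * sgn R (x i))) =
  Ex 2^-1 (fun x : cube n => F (fun i => sgn R (x i))).
Proof.
pose h x : cube n := [ffun i => if s i then x i else ~~ x i].
have hK : involutive h.
  by move=> x; apply/ffunP => i; rewrite !ffunE; case: (s i); rewrite ?negbK.
rewrite /Ex [RHS](reindex_inj (inv_inj hK)); apply: eq_bigr => x _.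
rewrite -!sigma_mu; congr (_ * F _); apply/funext => i; rewrite ffunE /sgn.
by case: (s i); case: (x i); rewrite ?mul1r ?mulN1r ?opprK.
Qed.

Lemma Rad_sign s v : Rad (fun i => sgn R (s i) *: v i) = Rad v.
Proof.
rewrite /Rad -(Ex_sign s (fun c => `|\sum_i c i *: v i|)); apply: eq_Ex => x.
by congr `|_|; apply: eq_bigr => i _; rewrite scalerA mulrC.
Qed.

(* A coefficient in {-1, 0, 1} is the half-sum of two signs. *)
Lemma contraction (q : R) (c : 'I_n -> R) s t v : 1 <= q ->
  (forall i, c i = (sgn R (s i) + sgn R (t i)) / 2) ->
  Ex 2^-1 (fun x : cube n => `|\sum_i (c i * sgn R (x i)) *: v i| `^ q) <=
  Ex 2^-1 (fun x : cube n => `|\sum_i sgn R (x i) *: v i| `^ q).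
Proof.
move=> q1 cE.
pose S (u x : cube n) := `|\sum_i (sgn R (u i) * sgn R (x i)) *: v i|.
have inv u : Ex 2^-1 (fun x => S u x `^ q) =
    Ex 2^-1 (fun x : cube n => `|\sum_i sgn R (x i) *: v i| `^ q).
  exact: (Ex_sign u (fun c => `|\sum_i c i *: v i| `^ q)).
apply: (@le_trans _ _ (Ex 2^-1 (fun x => 2^-1 * (S s x `^ q + S t x `^ q)))); last first.
  by rewrite ExZ ExD !inv; lra.
apply: (le_Ex h01) => x; rewrite mulrC.
apply: le_trans (powR_midpoint q1 (normr_ge0 _) (normr_ge0 _)).
apply: le_powR => //; first by lra.
have -> : \sum_i (c i * sgn R (x i)) *: v i =
    2^-1 *: (\sum_i (sgn R (s i) * sgn R (x i)) *: v i + \sum_i (sgn R (t i) * sgn R (x i)) *: v i).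
  rewrite -big_split scaler_sumr; apply: eq_bigr => i _ /=.
  by rewrite -scalerDl scalerA cE; congr (_ *: _); lra.
rewrite normrZ ger0_norm; last by lra.
by rewrite mulrC ler_wpM2r ?ler_normD //; lra.
Qed.

Lemma contraction1 (c : 'I_n -> R) s t v :
  (forall i, c i = (sgn R (s i) + sgn R (t i)) / 2) ->
  Ex 2^-1 (fun x : cube n => `|\sum_i (c i * sgn R (x i)) *: v i|) <= Rad v.
Proof.
move=> cE; have := contraction v (lexx 1) cE; rewrite /Rad.
by under eq_Ex do rewrite powRr1 //; under [leRHS]eq_Ex do rewrite powRr1 //.
Qed.

Lemma Ex_coord (r : R) (i : 'I_n) : Ex r (fun b : cube n => (b i)%:R) = r.
Proof.
rewrite -(Ex_ravg r i) -[RHS](Ex_cst r n r); apply: eq_Ex => b.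
by rewrite /ravg !ffunE eqxx /=; lra.
Qed.

(** Jensen replaces the mean r by an independent copy b'. Exchanging b and b' on the coordinates
    where x is -1 keeps their joint law and produces the signs. *)
Lemma Wnorm_symmetrize (r : R) v : 0 <= r <= 1 ->
  Wnorm r v <= Ex r (fun b : cube n => Ex r (fun b' : cube n =>
    Ex 2^-1 (fun x : cube n => `|\sum_i (((b i)%:R - (b' i)%:R) * sgn R (x i)) *: v i|))).
Proof.
move=> r01; pose D (b b' : cube n) := `|\sum_i ((b i)%:R - (b' i)%:R) *: v i|.
apply: (@le_trans _ _ (Ex r (fun b : cube n => Ex r (fun b' : cube n => D b b')))).
  apply: (le_Ex r01) => b.
  have -> : \sum_i ((b i)%:R - r) *: v i =
      \sum_(b' : cube n) mu r b' *: \sum_i ((b i)%:R - (b' i)%:R) *: v i.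
    under [RHS]eq_bigr do rewrite scaler_sumr.
    rewrite exchange_big /=; apply: eq_bigr => i _.
    under eq_bigr do rewrite scalerA; rewrite -scaler_suml; congr (_ *: _).
    under eq_bigr do rewrite mulrBr; rewrite sumrB -mulr_suml sum_mu mul1r.
    by have := Ex_coord r i; rewrite /Ex => ->.
  apply: le_trans (ler_norm_sum _ _ _) _; apply: ler_sum => b' _.
  by rewrite normrZ ger0_norm // mu_ge0.
rewrite -[leLHS](Ex_cst 2^-1 n).
under [leRHS]eq_Ex => b do rewrite exchange_Ex.
rewrite [leRHS]exchange_Ex; apply: (le_Ex h01) => x.
rewrite -(Ex_swap r x D); apply: (le_Ex r01) => b; apply: (le_Ex r01) => b'.
rewrite /D le_eqVlt; apply/orP; left; apply/eqP; congr `|_|; apply: eq_bigr => i _.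
by rewrite !ffunE /sgn; congr (_ *: _); case: (x i); ring.
Qed.

Lemma Wnorm_le_Rad (r : R) v : 0 <= r <= 1 -> Wnorm r v <= Rad v.
Proof.
move=> r01; apply: le_trans (Wnorm_symmetrize v r01) _.
rewrite -[leRHS](Ex_cst r n); apply: (le_Ex r01) => b.
rewrite -[leRHS](Ex_cst r n); apply: (le_Ex r01) => b'.
(* b - b' takes values in {-1, 0, 1}: it is the half-sum of the signs of b and of the negation of
   b'. *)
apply: (@contraction1 _ b [ffun i => ~~ b' i]) => i.
by rewrite ffunE /sgn; case: (b i); case: (b' i) => /=; lra.
Qed.

(** The Rademacher average of the v_i over a random set that contains each index with probability
    r. *)
Definition Urad (r : R) v : R := Ex r (fun b : cube n =>
  Ex 2^-1 (fun x : cube n => `|\sum_i ((b i)%:R * sgn R (x i)) *: v i|)).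

Lemma Urad_ge0 r v : 0 <= r <= 1 -> 0 <= Urad r v.
Proof. by move=> r01; do 2!apply: Ex_ge0 => // ?. Qed.

Lemma Wnorm_le_Urad (r : R) v : 0 <= r <= 1 -> Wnorm r v <= 2 * Urad r v.
Proof.
move=> r01; apply: le_trans (Wnorm_symmetrize v r01) _.
pose G (b : cube n) := Ex 2^-1 (fun x : cube n => `|\sum_i ((b i)%:R * sgn R (x i)) *: v i|).
have -> : 2 * Urad r v = Ex r (fun b => Ex r (fun b' => G b + G b')).
  under eq_Ex do rewrite ExD Ex_cst.
  by rewrite ExD Ex_cst /Urad -/G; ring.
apply: (le_Ex r01) => b; apply: (le_Ex r01) => b'; rewrite -ExD; apply: (le_Ex h01) => x.
under eq_bigr do rewrite mulrBl scalerBl.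
by rewrite sumrB ler_normB.
Qed.

(** Kahane's inequality from concentration at alpha = 1/2. The derivatives of x -> sum_i x_i v_i are
    x_i v_i, whose Rademacher average is [Rad v] at every x, so the gradient bound is a constant; e
    keeps the scale positive. *)
Lemma kahane_eps (q e : R) v : 1 <= q -> 0 < e ->
  Ex 2^-1 (fun x : cube n => `|\sum_i sgn R (x i) *: v i| `^ q) <=
  ((4 * Korl q 2 + Corl R) * (Rad v + e)) `^ q.
Proof.
move=> q1 e0; set V := Rad v; have V0 : 0 <= V by exact: Rad_ge0.
pose S (x : cube n) : X := \sum_i sgn R (x i) *: v i.
have a01 : 0 < (2^-1 : R) < 1 by apply/andP; split; lra.
have ak : (2^-1 : R)^-1 <= 2 by rewrite invrK.
have bk : (1 - 2^-1 : R)^-1 <= 2.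
  by have -> : (1 - 2^-1 : R) = 2^-1 by lra; rewrite invrK.
have dS i x : dpart 2^-1 S i x = sgn R (x i) *: v i.
  have half : (1 - 2^-1 : R) = 2^-1 by lra.
  have := sub_flip a01 S x i; rewrite half if_same invrK => h.
  have {h} : 2^-1 *: (S x - S (flip x i)) = dpart 2^-1 S i x.
    by rewrite h scalerA mulVf ?scale1r // pnatr_eq0.
  move=> <-; rewrite /S -sumrB (bigD1 i) //= big1 ?addr0 => [|j ji].
    rewrite sgn_flip eqxx scaleNr opprK -scalerDl scalerA; congr (_ *: _); lra.
  by rewrite sgn_flip (negPf ji) subrr.
have gN x : grad (fun x => `|S x|) x <= 4 * (V + e).
  apply: le_trans (grad_norm_le_Rad a01 ak bk S x) _.
  have -> : Rad (fun i => dpart 2^-1 S i x) = V.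
    by rewrite /V -(Rad_sign x v); congr Rad; apply/funext => i; rewrite dS.
  lra.
have VE : 0 < V + e by rewrite ltr_wpDl.
have VE4 : 0 < 4 * (V + e) by rewrite mulr_gt0.
have K0 := Korl_gt0 q1 a01 ak; have C0 := Corl_gt0 R.
set g := (4 * Korl q 2 + Corl R) * (V + e).
have gE : Korl q 2 * (4 * (V + e)) + Corl R * (V + e) = g by rewrite /g; ring.
have g0 : 0 < g by rewrite mulr_gt0 // addr_gt0 // mulr_gt0.
have hS : Ex 2^-1 (fun x => `|S x|) <= V + e by rewrite -[V]/(Ex 2^-1 (fun x => `|S x|)) lerDl ltW.
have hN : Ex 2^-1 (fun _ : cube n => (4 * (V + e)) `^ q) <= (4 * (V + e)) `^ q by rewrite Ex_cst.
have := Phi_concentration q1 a01 ak bk (fun x => normr_ge0 (S x)) gN VE4 VE hN hS.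
rewrite gE => h.
have gq : 0 < g `^ q by exact: powR_gt0.
have -> : Ex 2^-1 (fun x => `|S x| `^ q) = g `^ q * Ex 2^-1 (fun x => (`|S x| / g) `^ q).
  rewrite -ExZ; apply: eq_Ex => x.
  by rewrite -powRM ?(ltW g0) ?divr_ge0 ?(ltW g0) // mulrC divfK // gt_eqF.
rewrite -[leRHS]mulr1; apply: ler_wpM2l; first exact: ltW.
apply: le_trans h; apply: (le_Ex h01) => x.
by apply: (powR_le_Phi q1); rewrite divr_ge0 // ltW.
Qed.

End Contraction.

Section Labels.
Variable R : realType.
Variables (m n : nat) (r : R).
Hypotheses (r01 : 0 <= r <= 1) (mr : m%:R * r <= 1).

(** A labelling carries m disjoint copies of the random set behind [Urad], so that cotype can be
    applied to all of them at once. *)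
Definition label := {ffun 'I_n -> 'I_m.+1}.

(* Label k > 0 has probability r each; label 0 collects the remaining mass. *)
Definition wlab (t : 'I_m.+1) : R := if t == ord0 then 1 - m%:R * r else r.

Definition mulab (l : label) : R := \prod_i wlab (l i).

Lemma wlab_ge0 t : 0 <= wlab t.
Proof. by rewrite /wlab; case: ifP => _; [rewrite subr_ge0|case/andP: r01]. Qed.

Lemma mulab_ge0 l : 0 <= mulab l.
Proof. by apply: prodr_ge0 => i _; exact: wlab_ge0. Qed.

Lemma sum_wlab : \sum_t wlab t = 1.
Proof.
rewrite big_ord_recl /= (eq_bigr (fun=> r)) => [|i _]; last by [].
by rewrite sumr_const card_ord -mulr_natl subrK.
Qed.

Lemma sum_mulab : \sum_l mulab l = 1.
Proof.
rewrite -(bigA_distr_bigA (fun (_ : 'I_n) t => wlab t)).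
by rewrite big1 // => i _; exact: sum_wlab.
Qed.

Definition in_label (k : 'I_m) (l : label) : cube n := [ffun i => l i == lift ord0 k].

Lemma sum_in_label k (H : cube n -> R) :
  \sum_l mulab l * H (in_label k l) = Ex r H.
Proof.
rewrite (partition_big (in_label k) xpredT) //=; apply: eq_bigr => b _.
under eq_bigr => l /eqP lb do rewrite lb.
rewrite -mulr_suml; congr (_ * _).
pose Q i (t : 'I_m.+1) := (t == lift ord0 k) == b i.
transitivity (\sum_(l in family Q) mulab l).
  apply: eq_bigl => l; apply/eqP/familyP => [lb i|lQ].
    by rewrite unfold_in /Q -lb ffunE.
  by apply/ffunP => i; have := lQ i; rewrite unfold_in ffunE => /eqP.
rewrite -(bigA_distr_big_dep Q (fun _ t => wlab t)); apply: eq_bigr => i _.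
have wk : wlab (lift ord0 k) = r by [].
rewrite /Q; case: (b i).
  by rewrite (eq_bigl (pred1 (lift ord0 k))) ?big_pred1_eq // => t; rewrite eqb_id.
have := sum_wlab; rewrite (bigD1 (lift ord0 k)) //= wk => h.
rewrite -h addrC addrK; apply: eq_bigl => t; by rewrite eqbF_neg.
Qed.

End Labels.

(** * The gain from cotype for sparse random sets *)

Section CotypeBound.
Variables (R : realType) (X : normedModType R) (q C : R).
Hypotheses (q2 : 2 <= q) (C0 : 0 < C).
Hypothesis cot : forall (n : nat) (v : 'I_n -> X),
  C `^ (- q) * \sum_(i < n) `|v i| `^ q <=
  \sum_(x : cube n) sigma R x * (`| \sum_(i < n) sgn R (x i) *: v i | `^ q).

Let q1 : 1 <= q. Proof. by have := q2; lra. Qed.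

Let h01 := half01 R.

(** Cotype is applied to the m partial sums over the label classes. As the classes are disjoint,
    their signed sum is one Rademacher sum with coefficients in {-1, 0, 1}; contraction and
    [kahane_eps] bound it by the full average. *)
Lemma cotype_Urad (m n : nat) (r e : R) (v : 'I_n -> X) :
  0 <= r <= 1 -> m%:R * r <= 1 -> 0 < e ->
  m%:R * Urad r v `^ q <= (C * ((4 * Korl q 2 + Corl R) * (Rad v + e))) `^ q.
Proof.
move=> r01 mr e0; set M := _ * (_ + e).
pose S (b x : cube n) : X := \sum_i ((b i)%:R * sgn R (x i)) *: v i.
have U1 : Urad r v `^ q <= Ex r (fun b => Ex 2^-1 (fun x => `|S b x| `^ q)).
  apply: le_trans (jensen_Ex q1 r01 _) _ => [b|]; first by apply: (Ex_ge0 h01).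
  by apply: (le_Ex r01) => b; apply: jensen_Ex => // x; exact: normr_ge0.
have M0 : 0 <= M.
  have K0 : 0 < Korl q (2 : R).
    by apply: (@Korl_gt0 R q q1 2^-1 2); [apply/andP; split; lra|rewrite invrK].
  apply: mulr_ge0; last by apply: addr_ge0; [exact: Rad_ge0|exact: ltW].
  by apply: addr_ge0; [apply: mulr_ge0 => //; exact: ltW|exact: ltW (Corl_gt0 R)].
have Cq : 0 < C `^ q by exact: powR_gt0.
rewrite powRM ?(ltW C0) //; apply: (@le_trans _ _ (C `^ q *
    Ex 2^-1 (fun x : cube n => `|\sum_i sgn R (x i) *: v i| `^ q))); last first.
  by rewrite ler_pM2l //; exact: kahane_eps.
rewrite -ler_pdivrMl // -powRN.
apply: (@le_trans _ _ (\sum_(l : label m n) mulab r l * (C `^ (- q) *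
    \sum_(k < m) Ex 2^-1 (fun x => `|S (in_label k l) x| `^ q)))).
  under eq_bigr do rewrite mulrCA mulr_sumr.
  rewrite -mulr_sumr exchange_big /=; apply: ler_wpM2l; first exact: powR_ge0.
  under eq_bigr => k _ do
    rewrite (sum_in_label r k (fun b => Ex 2^-1 (fun x => `|S b x| `^ q))).
  by rewrite sumr_const card_ord -[leRHS]mulr_natl; apply: ler_wpM2l.
rewrite -[leRHS]mul1r -[X in _ <= X * _](sum_mulab m n r) mulr_suml; apply: ler_sum => l _.
apply: ler_wpM2l; first exact: mulab_ge0.
rewrite -Ex_sum -ExZ.
apply: (@le_trans _ _ (Ex 2^-1 (fun x => Ex 2^-1 (fun d : cube m =>
    `|\sum_(k < m) sgn R (d k) *: S (in_label k l) x| `^ q)))).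
  apply: (le_Ex h01) => x; apply: le_trans (cot _) _.
  by rewrite le_eqVlt; apply/orP; left; apply/eqP; apply: eq_bigr => d _; rewrite sigma_mu.
rewrite exchange_Ex -[leRHS](Ex_cst 2^-1 m); apply: (le_Ex h01) => d.
(* The two sides agree with d_k on class k and are opposite on label 0, so their half-sum is d_k or
   0. *)
pose side (c : bool) : cube n :=
  [ffun i => if unlift ord0 (l i) is Some k then d k else c].
have := @contraction R X n q (fun i => (sgn R (side true i) + sgn R (side false i)) / 2)
  (side true) (side false) v q1 (fun=> erefl).
apply: le_trans.
apply: (le_Ex h01) => x; rewrite le_eqVlt; apply/orP; left; apply/eqP.
congr (`|_| `^ _); rewrite /S.
under eq_bigr do rewrite scaler_sumr.
rewrite exchange_big /=; apply: eq_bigr => i _.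
under eq_bigr do rewrite scalerA mulrA.
rewrite -scaler_suml -mulr_suml; congr ((_ * _) *: _); rewrite !ffunE.
case: unliftP => [k lk|lk].
  rewrite (bigD1 k) //= ffunE lk eqxx mulr1 big1 ?addr0 => [|j jk]; first lra.
  by rewrite ffunE lk (inj_eq lift_inj) eq_sym (negPf jk) mulr0.
rewrite big1 => [|j _]; first by rewrite /sgn; lra.
by rewrite ffunE lk (negPf (neq_lift _ _)) mulr0.
Qed.

Definition Kcot : R := 2 * (C * (4 * Korl q 2 + Corl R)).

Lemma Kcot_ge0 : 0 <= Kcot.
Proof.
have K0 : 0 < Korl q (2 : R).
  by apply: (@Korl_gt0 R q q1 2^-1 2); [apply/andP; split; lra|rewrite invrK].
rewrite /Kcot; apply: mulr_ge0 => //; apply: mulr_ge0; first exact: ltW.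
by apply: addr_ge0; [apply: mulr_ge0 => //; exact: ltW|exact: ltW (Corl_gt0 R)].
Qed.

Lemma cotype_Wnorm n k (r : R) (v : 'I_n -> X) :
  (2^-1 : R) ^+ k.+2 <= r <= 2^-1 ^+ k.+1 ->
  Wnorm r v <= Kcot * (2^-1 `^ q^-1) ^+ k.+1 * Rad v.
Proof.
move=> /andP[rk1 rk2].
have q0 : 0 < q by have := q2; lra.
have h0 j : 0 < (2^-1 : R) ^+ j by rewrite exprn_gt0 // invr_gt0.
have h1 j : (2^-1 : R) ^+ j <= 1 by rewrite exprn_ile1 //; lra.
have r01 : 0 <= r <= 1.
  by have := h0 k.+2; have := h1 k.+1; move=> ? ?; apply/andP; split; lra.
apply: le_trans (Wnorm_le_Urad v r01) _.
set th := 2^-1 `^ q^-1.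
have th0 : 0 < th by rewrite powR_gt0 // invr_gt0.
have thq : (th ^+ k.+1) `^ q = 2^-1 ^+ k.+1.
  rewrite -powR_mulrn ?(ltW th0) // -powRrM mulrC powRrM /th powR_invK ?powR_mulrn //.
have U0 := Urad_ge0 v r01.
(* The range of r leaves room for m = 2^(k+1) disjoint random sets; the gain is the q-th root of 1 /
   m. *)
have mr : (2 ^ k.+1)%:R * r <= 1.
  rewrite mulrC -ler_pdivlMr ?ltr0n ?expn_gt0 // div1r.
  by rewrite natrX -exprVn.
have Kc := Kcot_ge0.
suff bound e : 0 < e -> 2 * Urad r v <= Kcot * th ^+ k.+1 * (Rad v + e).
  apply/ler_addgt0Pr => e e0.
  have c1 : 0 < Kcot * th ^+ k.+1 + 1 by rewrite ltr_wpDl // mulr_ge0 // exprn_ge0 // ltW.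
  have e1 : 0 < e / (Kcot * th ^+ k.+1 + 1) by rewrite divr_gt0.
  apply: le_trans (bound _ e1) _; rewrite mulrDr lerD2l mulrA ler_pdivrMr //.
  by rewrite mulrC ler_pM2l // lerDl.
move=> e0.
have Re : 0 <= Rad v + e by rewrite addr_ge0 ?Rad_ge0 // ltW.
have := cotype_Urad v r01 mr e0; set D := C * _ => key.
have -> : Kcot * th ^+ k.+1 * (Rad v + e) = 2 * (D * th ^+ k.+1).
  by rewrite /Kcot /D; ring.
have D0 : 0 <= D.
  have : 0 <= Kcot * (Rad v + e) by rewrite mulr_ge0.
  have -> : Kcot * (Rad v + e) = 2 * D by rewrite /Kcot /D; ring.
  lra.
rewrite ler_pM2l //; apply: (powR_inv_mono q0) => //.
  by rewrite mulr_ge0 // exprn_ge0 // ltW.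
rewrite powRM ?exprn_ge0 ?(ltW th0) // thq exprVn -natrX ler_pdivlMr ?ltr0n ?expn_gt0 //.
by rewrite mulrC.
Qed.

End CotypeBound.

(** * Conclusion *)

Section MainBounds.
Variable R : realType.
Implicit Types (a p : R).

Lemma le_powRr_sum p (x y : R) : 1 <= p -> 0 <= x -> 0 <= y -> x `^ p <= y -> x <= y `^ p^-1.
Proof.
move=> p1 x0 y0 xy; have p0 : 0 < p by lra.
by apply: (powR_inv_mono p0) => //; rewrite ?powR_ge0 // powR_invK.
Qed.

Lemma Lpnorm_powR p a (X : normedModType R) n (g : cube n -> X) : 1 <= p -> 0 <= a <= 1 ->
  Lpnorm p a g `^ p = Ex a (fun x => `|g x| `^ p).
Proof.
by move=> p1 a01; rewrite /Lpnorm powR_invK //; apply: Ex_ge0 => // x; exact: powR_ge0.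
Qed.

Lemma Lpnorm1 a (X : normedModType R) n (g : cube n -> X) : 0 <= a <= 1 ->
  Lpnorm 1 a g = Ex a (fun x => `|g x|).
Proof.
move=> a01; have := Lpnorm_powR g (lexx 1) a01; rewrite powRr1 ?powR_ge0 // => ->.
by apply: eq_Ex => x; rewrite powRr1.
Qed.

Section Fixed.
Variable a : R.
Hypothesis a01 : 0 < a < 1.

Let a01' : 0 <= a <= 1. Proof. by have /andP[? ?] := a01; rewrite !ltW. Qed.

Let h01 := half01 R.

Variables (X : normedModType R) (n : nat) (f : cube n -> X).

Lemma sum_sigma_Lpnorm1 :
  \sum_(d : cube n) sigma R d * Lpnorm 1 a (Dsum a f d) =
  Ex a (fun x => Rad (fun i => dpart a f i x)).
Proof.
rewrite /Rad exchange_Ex; apply: eq_bigr => d _.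
by rewrite sigma_mu Lpnorm1.
Qed.

Lemma sum_sigma_Lpnorm p : 1 <= p ->
  \sum_(d : cube n) sigma R d * Lpnorm p a (Dsum a f d) `^ p =
  Ex a (fun x => Ex 2^-1 (fun d : cube n => `|Dsum a f d x| `^ p)).
Proof.
move=> p1; rewrite exchange_Ex; apply: eq_bigr => d _.
by rewrite sigma_mu Lpnorm_powR.
Qed.

Lemma Ex_Rad_powR p : 1 <= p ->
  Ex a (fun x => Rad (fun i => dpart a f i x) `^ p) <=
  \sum_(d : cube n) sigma R d * Lpnorm p a (Dsum a f d) `^ p.
Proof.
move=> p1; rewrite sum_sigma_Lpnorm //; apply: (le_Ex a01') => x.
by apply: jensen_Ex => // d; exact: normr_ge0.
Qed.

Lemma Ex_Rad_le p : 1 <= p ->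
  Ex a (fun x => Rad (fun i => dpart a f i x)) <=
  (\sum_(d : cube n) sigma R d * Lpnorm p a (Dsum a f d) `^ p) `^ p^-1.
Proof.
move=> p1; have R0 x : 0 <= Rad (fun i => dpart a f i x) by exact: Rad_ge0.
apply: le_powRr_sum => //; first exact: Ex_ge0.
  rewrite sum_sigma_Lpnorm //; by apply: Ex_ge0 => // x; apply: Ex_ge0 => // d; exact: powR_ge0.
exact: le_trans (jensen_Ex p1 a01' R0) (Ex_Rad_powR p1).
Qed.

Definition kalpha : R := a^-1 + (1 - a)^-1.

Lemma kalpha_ge : a^-1 <= kalpha /\ (1 - a)^-1 <= kalpha.
Proof.
have /andP[a0 a1] := a01.
by rewrite /kalpha lerDl lerDr !invr_ge0 subr_ge0 !ltW.
Qed.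

Lemma orlicz_le_grad_and_mean p : 1 <= p ->
  orlicz p (p / 2) a (fun x => f x - mean a f) <=
  Korl p kalpha * (2 * kalpha) *
    (\sum_(d : cube n) sigma R d * Lpnorm p a (Dsum a f d) `^ p) `^ p^-1 +
  Corl R * Ex a (fun x => `|f x - mean a f|).
Proof.
move=> p1; have [ak bk] := kalpha_ge; have /andP[a0 a1] := a01.
set g := fun x => f x - mean a f.
(* The weights a and 1 - a add up to 1, so [dpart] kills constants. *)
have dg i x : dpart a g i x = dpart a f i x.
  have e : (1 - a) *: mean a f = mean a f - a *: mean a f by rewrite scalerBl scale1r.
  rewrite /dpart /g !scalerBr e.
  move: (mean a f) (a *: mean a f) (f x) (a *: f _) ((1 - a) *: f _) => c d u v w.
  rewrite !opprB !addrA [u - c + d - v + c]addrAC [u - c + d + c]addrAC subrK.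
  by rewrite [u + d - v - d]addrAC addrK.
have k0 : 0 < kalpha by apply: lt_le_trans ak; rewrite invr_gt0.
have gN x : grad (fun x => `|g x|) x <= 2 * kalpha * Rad (fun i => dpart a f i x).
  apply: le_trans (grad_norm_le_Rad a01 ak bk g x) _.
  by under eq_fun do rewrite dg.
apply: le_trans (orlicz_concentration p1 a01 ak bk gN) _; rewrite lerD2r -mulrA.
have K0 := Korl_gt0 p1 a01 ak.
rewrite ler_pM2l //.
have p0 : 0 < p by lra.
have kk : 0 <= 2 * kalpha by rewrite mulr_ge0 // ltW.
have -> : Ex a (fun x => (2 * kalpha * Rad (fun i => dpart a f i x)) `^ p) =
    (2 * kalpha) `^ p * Ex a (fun x => Rad (fun i => dpart a f i x) `^ p).
  by rewrite -ExZ; apply: eq_Ex => x; rewrite powRM // Rad_ge0.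
have E0 : 0 <= Ex a (fun x => Rad (fun i => dpart a f i x) `^ p).
  by apply: Ex_ge0 => // x; exact: powR_ge0.
move: (Ex_Rad_powR p1) E0; move: (Ex a _) (\sum_d _) => E S ES E0.
rewrite (powRM _ (powR_ge0 _ _) E0) -powRrM mulfV ?gt_eqF // powRr1 //.
apply: ler_wpM2l => //; apply: le_powR => //; by rewrite invr_ge0 ltW.
Qed.

Lemma mean_deviation_log :
  Ex a (fun x => `|f x - mean a f|) <=
  24 * (ln n%:R + 1) * \sum_(d : cube n) sigma R d * Lpnorm 1 a (Dsum a f d).
Proof.
rewrite sum_sigma_Lpnorm1; set V := Ex a (fun x => Rad _).
have V0 : 0 <= V by apply: Ex_ge0 => // x; exact: Rad_ge0.
(* t + 3 dyadic intervals reach r = 2^-(t+4), below 1 / (8 n). For n = 0 both [trunc_log] and [ln]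
   take the value 0. *)
pose t := trunc_log 2 n.
have nt : (8 * n <= 2 ^ (t + 3).+1)%N.
  have h : (n < 2 ^ t.+1)%N by apply: trunc_log_ltn.
  have -> : (2 ^ (t + 3).+1 = 8 * 2 ^ t.+1)%N by rewrite -addSn addnC expnD.
  by rewrite leq_mul2l ltnW.
have := @poincare_dyadic R X a a01 n f (t + 3) (fun=> 1) nt.
rewrite sumr_const card_ord -/V => /(_ _) h.
have {}h : Ex a (fun x => `|f x - mean a f|) <= 8 * (t + 3)%:R * V.
  apply: h => k r v /andP[r1 r2]; rewrite mul1r; apply: Wnorm_le_Rad.
  have p1 : 0 <= (2^-1 : R) ^+ k.+2 by rewrite exprn_ge0 // invr_ge0.
  have p2 : (2^-1 : R) ^+ k.+1 <= 1 by rewrite exprn_ile1 //; lra.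
  by apply/andP; split; lra.
apply: le_trans h _; apply: ler_wpM2r => //.
have tl : t%:R <= 2 * ln n%:R :> R.
  case: (posnP n) => [n0|n0]; first by rewrite /t n0 /= ln0 // mulr0.
  have ln2 : 1 <= 2 * ln 2 :> R.
    have := @ln_le_sub1 R 2^-1 ltac:(lra); rewrite lnV ?posrE //; lra.
  have : ln ((2 : R) ^+ t) <= ln n%:R.
    by rewrite ler_ln ?posrE ?exprn_gt0 ?ltr0n // -natrX ler_nat trunc_logP.
  rewrite lnXn // => h; have {}h : t%:R * ln 2 <= ln n%:R :> R by rewrite mulr_natl.
  have := ler_wpM2l (ler0n R t) ln2; lra.
by have := ler0n R t; rewrite natrD; lra.
Qed.

Lemma mean_deviation_cotype (q C : R) : 2 <= q -> 0 < C ->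
  (forall (m : nat) (v : 'I_m -> X),
    C `^ (- q) * \sum_(i < m) `|v i| `^ q <=
    \sum_(x : cube m) sigma R x * (`| \sum_(i < m) sgn R (x i) *: v i | `^ q)) ->
  Ex a (fun x => `|f x - mean a f|) <=
  8 * (Kcot q C / (1 - 2^-1 `^ q^-1)) * Ex a (fun x => Rad (fun i => dpart a f i x)).
Proof.
move=> q2 C0 cot; set V := Ex a (fun x => Rad _).
have V0 : 0 <= V by apply: Ex_ge0 => // x; exact: Rad_ge0.
set th := 2^-1 `^ q^-1.
have th0 : 0 < th by rewrite powR_gt0 // invr_gt0.
have th1 : th < 1.
  have q0 : 0 < q^-1 by rewrite invr_gt0; lra.
  have := @gt0_ltr_powR R q^-1 q0 2^-1 1; rewrite powR1; apply; rewrite ?nnegrE //; lra.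
have K0 : 0 <= Kcot q C by exact: Kcot_ge0.
(* The costs are now summable, so a crude number of intervals suffices. *)
have nt : (8 * n <= 2 ^ (8 * n).+1)%N by rewrite ltnW // ltnW // ltn_expl.
have := @poincare_dyadic R X a a01 n f (8 * n) (fun k => Kcot q C * th ^+ k.+1) nt.
move=> /(_ (@cotype_Wnorm R X q C q2 C0 cot n)) /le_trans; apply; rewrite -/V.
apply: ler_wpM2r => //; apply: ler_wpM2l => //.
rewrite -mulr_sumr; apply: ler_wpM2l => //.
have d0 : 0 < 1 - th by lra.
rewrite -[leRHS]mul1r ler_pdivlMr //.
suff -> : forall N, (\sum_(k < N) th ^+ k.+1) * (1 - th) = th - th ^+ N.+1.
  have := exprn_ge0 (8 * n).+1 (ltW th0); lra.
elim=> [|N IH]; first by rewrite big_ord0 mul0r expr1 subrr.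
by rewrite big_ord_recr /= mulrDl IH [th ^+ N.+2]exprSr; ring.
Qed.

End Fixed.
End MainBounds.

Unset Implicit Arguments.

Theorem theorem1p2 (R : realType) :
  (forall a : R, 0 < a < 1 ->
     exists Ca : R, 0 < Ca /\
       forall p : R, 1 <= p ->
         exists K : R, 0 < K /\
           forall (X : normedModType R) (n : nat) (f : cube n -> X),
             orlicz p (p / 2) a (fun x => f x - mean a f)
             <= K * (\sum_(d : cube n) sigma R d * (Lpnorm p a (Dsum a f d)) `^ p) `^ p^-1
                + Ca * (ln (n%:R) + 1) * \sum_(d : cube n) sigma R d * Lpnorm 1 a (Dsum a f d))
  /\
  (forall X : normedModType R, finite_cotype X ->
     forall (p a : R), 1 <= p -> 0 < a < 1 ->
       exists K : R, 0 < K /\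
         forall (n : nat) (f : cube n -> X),
           orlicz p (p / 2) a (fun x => f x - mean a f)
           <= K * (\sum_(d : cube n) sigma R d * (Lpnorm p a (Dsum a f d)) `^ p) `^ p^-1).
Proof.
split.
  move=> a a01; exists (24 * Corl R); split; first by rewrite mulr_gt0 ?Corl_gt0.
  move=> p p1; have [ak bk] := kalpha_ge a01; have /andP[a0 a1] := a01.
  have k0 : 0 < kalpha a by apply: lt_le_trans ak; rewrite invr_gt0.
  exists (Korl p (kalpha a) * (2 * kalpha a)); split.
    by rewrite mulr_gt0 ?mulr_gt0 // (Korl_gt0 p1 a01 ak).
  move=> X n f; apply: le_trans (orlicz_le_grad_and_mean a01 f p1) _.
  rewrite lerD2l.
  have -> (l s : R) : 24 * Corl R * (l + 1) * s = Corl R * (24 * (l + 1) * s) by ring.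
  by apply: ler_wpM2l; [exact: ltW (Corl_gt0 R)|exact: mean_deviation_log].
move=> X [q [q2 [C [C0 cot]]]] p a p1 a01.
have [ak bk] := kalpha_ge a01; have /andP[a0 a1] := a01.
have k0 : 0 < kalpha a by apply: lt_le_trans ak; rewrite invr_gt0.
have K0 : 0 < Korl p (kalpha a) * (2 * kalpha a).
  by rewrite mulr_gt0 ?mulr_gt0 // (Korl_gt0 p1 a01 ak).
set B := 8 * (Kcot q C / (1 - 2^-1 `^ q^-1)).
have c0 := Corl_gt0 R.
(* The second summand pays for E |f - E f|, whose L_1 Rademacher bound is raised to L_p by Jensen's
   inequality; the absolute value secures positivity. *)
exists (Korl p (kalpha a) * (2 * kalpha a) + Corl R * `|B|); split.
  by rewrite ltr_wpDr // mulr_ge0 // ltW.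
move=> n f; apply: le_trans (orlicz_le_grad_and_mean a01 f p1) _.
rewrite [leRHS]mulrDl lerD2l -mulrA ler_pM2l //.
apply: le_trans (mean_deviation_cotype a01 f q2 C0 cot) _.
have V0 : 0 <= Ex a (fun x => Rad (fun i => dpart a f i x)).
  by apply: Ex_ge0 => [|x]; [rewrite !ltW|exact: Rad_ge0].
apply: le_trans (ler_wpM2r V0 (ler_norm B)) _.
by apply: ler_wpM2l => //; exact: Ex_Rad_le.
Qed.
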